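(* Consider the Rademacher prior $\mathcal X_{\mathrm{Rade}}$ (the entries of $x\in\mathbb R^n$ are i.i.d. uniform on $\{\pm1/\sqrt n\}$). For each $d\ge3$ there exists a bound $\lambda^*_{\mathrm{Rade},d}$, with $\lim_{d\to\infty}\lambda^*_{\mathrm{Rade},d}=2\sqrt{\log2}$, such that for every $d$: (1) if $\lambda<\lambda^*_{\mathrm{Rade},d}$, then weak detection and weak recovery are impossible for $\mathrm{WT}(d,\lambda,\mathcal X_{\mathrm{Rade}})$; (2) if $\lambda>2\sqrt{\log2}$, then strong detection and weak recovery are possible for $\mathrm{WT}(d,\lambda,\mathcal X_{\mathrm{Rade}})$.
   Context: Wigner tensor: for integers $d\ge2$, $n\ge1$, $\mathrm{WT}(d)=\mathrm{WT}_n(d)$ is the law of the symmetric tensor $W\in(\mathbb R^n)^{\otimes d}$ obtained by drawing $W'\in\mathbb R^{n^d}$ with i.i.d. $\mathcal N(0,2/n)$ entries and averaging it over all $d!$ permutations of the indices. Inner products of tensors are entrywise. Spiked model: a prior $\mathcal X=\{\mathcal X_n\}$ is a family of distributions on unit vectors of $\mathbb R^n$. For $\lambda\ge0$ (not depending on $n$), $\mathrm{WT}(d,\lambda,\mathcal X)$ is the law of $T=\lambda x^{\otimes d}+W$ with $x\sim\mathcal X_n$ and $W\sim\mathrm{WT}_n(d)$ independent. All statements are in the limit $n\to\infty$ with $d,\lambda$ fixed. Detection and recovery: one is given a single sample from either $\mathrm{WT}(d,\lambda,\mathcal X)$ or $\mathrm{WT}(d)$, each chosen with probability $1/2$. Strong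 detection: decide which one with success probability $1-o(1)$ as $n\to\infty$. Weak detection: decide with success probability at least $\frac12+\varepsilon$ as $n\to\infty$, for some $\varepsilon>0$ not depending on $n$. Weak recovery: given a sample $T$ from $\mathrm{WT}(d,\lambda,\mathcal X)$, output a unit vector $\hat x=\hat x(T)$ with $\mathbb E[\langle x,\hat x\rangle^d]\ge\varepsilon$ as $n\to\infty$, for some $\varepsilon>0$ not depending on $n$. These are information-theoretic notions; there is no computational restriction. $\log$ is the natural logarithm. *)

(* Defs.v *)
From HB Require Import structures.
From mathcomp Require Import all_boot all_order all_algebra all_fingroup.
From mathcomp Require Import all_classical all_reals all_analysis.
From mathcomp Require Import measurable_realfun.

Set Implicit Arguments.
Unset Strict Implicit.
Unset Printing Implicit Defensive.

Import Order.TTheory GRing.Theory Num.Theory.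
Import numFieldNormedType.Exports.

Local Open Scope classical_set_scope.
Local Open Scope ring_scope.

Section iid.
Context d (T : measurableType d) (R : realType).

Definition cons_pair n (p : T * n.-tuple T) : n.+1.-tuple T :=
  [the n.+1.-tuple T of p.1 :: p.2].

Lemma measurable_cons_pair n :
  measurable_fun [set: T * n.-tuple T] (@cons_pair n).
Proof. exact: measurable_cons. Qed.

HB.instance Definition _ n :=
  isMeasurableFun.Build _ _ _ _ (@cons_pair n) (@measurable_cons_pair n).

(* Law of n independent draws from P. *)
Fixpoint iid (P : probability T R) n : probability (n.-tuple T) R :=
  match n with
  | 0 => \d_[tuple]
  | m.+1 => distribution (P \x iid P m)%E (@cons_pair m)
  end.

Lemma iid_rect (P : probability T R) n (A : 'I_n -> set T) :
  (forall i, measurable (A i)) ->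
  iid P n [set x | forall i, A i (tnth x i)] = (\prod_(i < n) P (A i))%E.
Proof.
elim: n A => [|n IHn] A mA /=.
  rewrite big_ord0 /dirac indicE mem_set//.
  by case.
rewrite big_ord_recl -IHn; last by move=> i; exact: mA.
rewrite -product_measure1E//; last first.
  rewrite (_ : [set _ | _] =
    \bigcap_(i in [set: 'I_n]) ((@tnth n T)^~ i @^-1` A (lift ord0 i))).
    apply: fin_bigcap_measurable => // i _.
    by rewrite -[X in measurable X]setTI; exact: measurable_tnth.
  by apply/seteqP; split => x /= Ax i; [move=> _|]; exact: Ax.
rewrite /distribution /pushforward /=; congr (_ _).
apply/seteqP; split => -[a x] /=.
  move=> Ax; split; first by have := Ax ord0; rewrite /cons_pair.
  by move=> i; have := Ax (lift ord0 i); rewrite /cons_pair/= tnthS.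
move=> [Aa Ax] i; have [->//|] := eqVneq i ord0.
case: (unliftP ord0 i) => [j ->|->]; last by rewrite eqxx.
by move=> _; rewrite /cons_pair/= tnthS; exact: Ax.
Qed.

End iid.

Section tensors.
Variable R : realType.

Definition vec n := n.-tuple (measurableTypeR R).

Definition inner n (x y : vec n) : R := \sum_(i < n) tnth x i * tnth y i.

(* An element of (R^n)^{\otimes d} is the tuple of its n ^ d entries, listed
   along the enumeration of the multi-indices 'I_d -> 'I_n; on tuples the
   library provides the product sigma-algebra. *)
Definition tensor d n :=
  #|{ffun 'I_d -> 'I_n}|.-tuple (measurableTypeR R).

Definition entry d n (T : tensor d n) (i : {ffun 'I_d -> 'I_n}) : R :=
  tnth T (enum_rank i).

Definition mktensor d n (f : {ffun 'I_d -> 'I_n} -> R) : tensor d n :=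
  [tuple f (enum_val k) | k < #|{ffun 'I_d -> 'I_n}|].

Definition tpow d n (x : vec n) : tensor d n :=
  mktensor (fun i => \prod_(k < d) tnth x (i k)).

Definition symmetrize d n (w : tensor d n) : tensor d n :=
  mktensor (fun i =>
    (d`!%:R)^-1 * \sum_(s : 'S_d) entry w [ffun k => i (s k)]).

Definition spike d n (lambda : R) (p : vec n * tensor d n) : tensor d n :=
  mktensor (fun i => lambda * entry (tpow d p.1) i + entry p.2 i).

Lemma measurable_symmetrize d n :
  measurable_fun [set: tensor d n] (@symmetrize d n).
Proof.
apply/measurable_fun_tnthP => k.
rewrite (_ : _ \o _ = fun w => (d`!%:R)^-1 *
  \sum_(s : 'S_d) entry w [ffun l => enum_val k (s l)]); last first.
  by apply/funext => w /=; rewrite tnth_mktuple.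
apply: measurable_funM => //; apply: measurable_sum => s.
exact: measurable_tnth.
Qed.

HB.instance Definition _ d n :=
  isMeasurableFun.Build _ _ _ _ (@symmetrize d n) (@measurable_symmetrize d n).

Lemma measurable_spike d n lambda :
  measurable_fun [set: vec n * tensor d n] (@spike d n lambda).
Proof.
apply/measurable_fun_tnthP => k.
rewrite (_ : _ \o _ = fun p : vec n * tensor d n =>
  lambda * (\prod_(l < d) tnth p.1 ((enum_val k : {ffun 'I_d -> 'I_n}) l))
  + tnth p.2 k); last first.
  apply/funext => p /=.
  by rewrite /spike /mktensor tnth_mktuple /entry tnth_mktuple enum_valK.
apply: measurable_funD.
  apply: measurable_funM => //; apply: measurable_prod => l _.
  exact: (measurableT_comp (measurable_tnth _)).
exact: (measurableT_comp (measurable_tnth _)).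
Qed.

HB.instance Definition _ d n lambda :=
  isMeasurableFun.Build _ _ _ _ (@spike d n lambda) (@measurable_spike d n lambda).

End tensors.

Section models.
Variable R : realType.

(* normal_prob takes a mean and a standard deviation. *)
Definition wigner d n : probability (tensor R d n) R :=
  distribution
    (iid (normal_prob 0 (Num.sqrt (2 / n%:R))) #|{ffun 'I_d -> 'I_n}|)
    (@symmetrize R d n).

Definition prior := forall n, probability (vec R n) R.

(* Joint law of the independent pair (x, W); the observation is
   spike lambda (x, W). *)
Definition spike_noise (X : prior) d n :
    probability (vec R n * tensor R d n)%type R :=
  (X n \x wigner d n)%E.

Definition spiked (X : prior) d lambda n : probability (tensor R d n) R :=
  distribution (spike_noise X d n) (@spike R d n lambda).

Definition scaled_sign n (b : bool) : measurableTypeR R :=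
  (-1) ^+ b / Num.sqrt n%:R.

Lemma measurable_scaled_sign n : measurable_fun [set: bool] (scaled_sign n).
Proof. by []. Qed.

HB.instance Definition _ n :=
  isMeasurableFun.Build _ _ _ _ (scaled_sign n) (@measurable_scaled_sign n).

Definition rademacher : prior :=
  fun n => iid (distribution (bernoulli_prob 2^-1) (scaled_sign n)) n.

Local Open Scope ereal_scope.

(* The two hypotheses have prior probability 1/2 each; a test answers true for
   the spiked model. *)
Definition success d n (P Q : probability (tensor R d n) R)
    (f : {mfun tensor R d n >-> bool}) : \bar R :=
  (2^-1)%:E * P (f @^-1` [set true]) + (2^-1)%:E * Q (f @^-1` [set false]).

Definition strong_detection (X : prior) d lambda : Prop :=
  exists f : forall n, {mfun tensor R d n >-> bool},
    success (spiked X d lambda n) (wigner d n) (f n) @[n --> \oo] --> 1.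

Definition weak_detection (X : prior) d lambda : Prop :=
  exists2 eps : R, (0 < eps)%R &
  exists f : forall n, {mfun tensor R d n >-> bool},
    \forall n \near \oo,
      (2^-1 + eps)%:E <= success (spiked X d lambda n) (wigner d n) (f n).

(* There is no unit vector in dimension 0, hence the restriction on n. *)
Definition weak_recovery (X : prior) d lambda : Prop :=
  exists2 eps : R, (0 < eps)%R &
  exists2 xhat : forall n, {mfun tensor R d n >-> vec R n},
    (forall n T, (0 < n)%N -> inner (xhat n T) (xhat n T) = 1%R) &
    \forall n \near \oo,
      eps%:E <= 'E_(spike_noise X d n)
        [fun p => (inner p.1 (xhat n (spike lambda p)) ^+ d)%R].

End models.

(* Main.v *)
(*
Write u_b(w) = <x_b^{(d)}, w> for the score of a cube vector x_b, and s^2 = 2/n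
for the noise variance. The spiked law is a mixture over b of shifts of the null
law along symmetric tensors, so symmetrization of the noise plays no role and
everything reduces to i.i.d. Gaussian entries.

Above 2 sqrt(ln 2): under the null law the 2^n scores have Gaussian tails
exp(-n t^2/4), so none exceeds t > 2 sqrt(ln 2), whereas the planted vector has
score close to lambda. Thresholding the scores detects the spike, and any vector
x_b whose score passes the threshold has <x_b, x>^d bounded below.

Below: truncate the likelihood ratio L_b of each planted vector to the event
u_b <= lambda + delta, which costs o(1). The truncated second moment of a pair
with r = max(0, <x_b, x_b'>^d) is at most exp(n a r/(1+r)) with
a = (lambda^2 + 2 lambda delta)/2. For r = 1 the exponent is n a/2 < n ln 2,
which yields the sharp constant when d is large. Averaging over pairs, the
truncated second moment is 1 + o(1), which rules out detection, and the expected
squared norm of the posterior-weighted tensor mean of L_b x_b^{(d)} is o(1),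
which rules out recovery.

The witness lambda^*_d is the supremum of the l <= 2 sqrt(ln 2) such that both
tasks are impossible for all lambda < l. Only its limit then needs an argument.
*)
From HB Require Import structures.
Require Import Defs.
From mathcomp Require Import all_boot all_order all_algebra all_fingroup.
From mathcomp Require Import all_classical all_reals all_analysis.
From mathcomp Require Import measurable_realfun ring lra zify.

Set Implicit Arguments.
Unset Strict Implicit.
Unset Printing Implicit Defensive.

Import Order.TTheory GRing.Theory Num.Theory.
Import numFieldNormedType.Exports.

Local Open Scope classical_set_scope.
Local Open Scope ring_scope.


(** * Gaussian shifts *)

Section density.
Local Open Scope ereal_scope.
Context d (T : measurableType d) (R : realType).
Variables (mu nu : {measure set T -> \bar R}) (g : T -> R).
Hypothesis mg : measurable_fun setT g.
Hypothesis g0 : forall x, (0 <= g x)%R.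
Hypothesis nuE : forall A, measurable A -> nu A = \int[mu]_(x in A) (g x)%:E.

Import HBNNSimple.

(** Monotone convergence along [nnsfun_approx] reduces both integrals to simple functions, and
    linearity over the fibres reduces those to indicators, where the claim is [nuE]. *)
Lemma ge0_integral_density (f : T -> \bar R) :
  measurable_fun setT f -> (forall x, 0 <= f x) ->
  \int[nu]_x f x = \int[mu]_x (f x * (g x)%:E).
Proof.
move=> mf f0; pose h := nnsfun_approx measurableT mf.
have cvgh x : (h n x)%:E @[n --> \oo] --> f x by exact: cvg_nnsfun_approx.
have ndh x : {homo (fun n => (h n x)%:E) : a b / (a <= b)%N >-> a <= b}.
  by move=> a b ab; rewrite lee_fin; exact/lefP/nd_nnsfun_approx.
have mgE : measurable_fun setT (fun x => (g x)%:E) by exact/measurable_EFinP.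
have mhE n : measurable_fun setT (fun x => (h n x)%:E).
  by apply/measurable_EFinP; exact: measurable_funP.
transitivity (limn (fun n => \int[nu]_x (h n x)%:E)).
  rewrite -monotone_convergence//.
    by apply: eq_integral => x _; exact/esym/cvg_lim.
  by move=> n x _; rewrite lee_fin.
transitivity (limn (fun n => \int[mu]_x ((h n x)%:E * (g x)%:E))); last first.
  rewrite -monotone_convergence//.
  - apply: eq_integral => x _; apply/cvg_lim => //.
    by apply: cvgeZr => //; exact: cvgh.
  - by move=> n; exact: emeasurable_funM.
  - by move=> n x _; rewrite mule_ge0 ?lee_fin.
  - by move=> x _ a b ab; rewrite lee_wpmul2r ?lee_fin//; exact: ndh.
congr (limn _); apply/funext => n.
have h0 r x : 0 <= (r * \1_(h n @^-1` [set r]) x)%:E.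
  exact: nnfun_muleindic_ge0.
have mh r : measurable_fun setT (fun x => (r * \1_(h n @^-1` [set r]) x)%:E).
  by apply/measurable_EFinP; exact: measurable_funM.
under eq_integral do rewrite fimfunE -fsumEFin//.
under [RHS]eq_integral.
  move=> x _; rewrite fimfunE -fsumEFin// ge0_mule_fsuml//; over.
rewrite !ge0_integral_fsum//; last 2 first.
- by move=> r; exact: emeasurable_funM.
- by move=> r x _; rewrite mule_ge0 ?h0 ?lee_fin.
apply: eq_fsbigr => r; rewrite inE => -[x _ <-{r}].
have mA : measurable (h n @^-1` [set h n x]) by exact: measurable_funPTI.
under eq_integral do rewrite EFinM.
under [RHS]eq_integral do rewrite EFinM -muleA.
rewrite !ge0_integralZl ?lee_fin//.
- congr *%E; rewrite integral_indic// setIT nuE//.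
  rewrite [LHS]integral_mkcond; apply: eq_integral => y _.
  rewrite /patch indicE; case: ifPn => _; first by rewrite mul1e.
  by rewrite mul0e.
- by apply: emeasurable_funM => //; exact/measurable_EFinP.
- by move=> y _; rewrite mule_ge0 ?lee_fin.
- exact/measurable_EFinP.
Qed.

End density.

Section lebesgue_shift.
Variable R : realType.
Local Notation mu := (@lebesgue_measure R).

Definition translate (h : R) (x : measurableTypeR R) : measurableTypeR R := x + h.

Lemma measurable_translate h : measurable_fun setT (translate h).
Proof. exact: measurable_funD. Qed.

HB.instance Definition _ h :=
  isMeasurableFun.Build _ _ _ _ (translate h) (measurable_translate h).

(** By uniqueness of Lebesgue measure it is enough to compare the two measures on half-open
    intervals. *)
Lemma lebesgue_measure_translate (h : R) (A : set (measurableTypeR R)) :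
  measurable A -> pushforward mu (translate h) A = mu A.
Proof.
move=> mA.
have := @lebesgue_measure_unique R (pushforward mu (translate h)) _ A mA => <- //.
move=> _ [[a b]] _ <-.
change (mu `]a, b]%classic = mu (translate h @^-1` `]a, b])).
rewrite (_ : _ @^-1` _ = `](a - h), (b - h)]%classic).
  rewrite !lebesgue_measure_itv/= !lte_fin ltrBrDr subrK.
  by case: ifP => //; rewrite -!EFinD => _; congr EFin; lra.
by apply/seteqP; split => x /=; rewrite !in_itv/= /translate; lra.
Qed.

Lemma ge0_integral_shift (h : R) (f : R -> \bar R) :
  measurable_fun [set: R] f -> (forall x, 0 <= f x)%E ->
  (\int[mu]_x f (x + h)%R = \int[mu]_x f x)%E.
Proof.
move=> mf f0.
transitivity (\int[pushforward mu (translate h)]_x f x)%E.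
  by rewrite ge0_integral_pushforward//; exact: measurable_translate.
apply: eq_measure_integral => A mA _; exact: lebesgue_measure_translate.
Qed.

End lebesgue_shift.

Section normal.
Variable R : realType.
Local Notation mu := (@lebesgue_measure R).

Lemma ge0_integral_normal_prob (m s : R) (f : R -> \bar R) :
  measurable_fun [set: R] f -> (forall x, 0 <= f x)%E ->
  (\int[normal_prob m s]_x f x = \int[mu]_x (f x * (normal_pdf m s x)%:E))%E.
Proof.
move=> mf f0; apply: ge0_integral_density => //.
- exact: measurable_normal_pdf.
- by move=> x; exact: normal_pdf_ge0.
Qed.

(** One-dimensional Cameron-Martin formula: translation invariance moves the shift from [f] to the
    density, and the exponential is the quotient of the Gaussian densities centred at [h] and at
    0. *)
Lemma normal_prob_shift (s h : R) (f : R -> \bar R) : s != 0 ->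
  measurable_fun [set: R] f -> (forall x, 0 <= f x)%E ->
  (\int[normal_prob 0 s]_x f (x + h)%R =
   \int[normal_prob 0 s]_x (f x * (expR ((h * x - h ^+ 2 / 2) / s ^+ 2)%R)%:E))%E.
Proof.
move=> s0 mf f0.
have mpdf m : measurable_fun [set: R] (fun x => (normal_pdf m s x)%:E).
  by apply/measurable_EFinP; exact: measurable_normal_pdf.
have mexp : measurable_fun [set: R] (fun x => expR ((h * x - h ^+ 2 / 2) / s ^+ 2)).
  apply: measurableT_comp => //; apply: measurable_funM => //.
  by apply: measurable_funB => //; exact: measurable_funM.
rewrite !ge0_integral_normal_prob//; last 3 first.
- by apply: emeasurable_funM => //; exact/measurable_EFinP.
- by move=> x; rewrite mule_ge0 ?lee_fin ?expR_ge0.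
- by apply: measurableT_comp => //; exact: measurable_funD.
rewrite -(@ge0_integral_shift R (- h)); last 2 first.
- apply: emeasurable_funM => //.
  by apply: measurableT_comp => //; exact: measurable_funD.
- by move=> x; rewrite mule_ge0 ?lee_fin ?normal_pdf_ge0.
apply: eq_integral => x _; rewrite subrK -muleA; congr (_ * _)%E.
rewrite -EFinM; congr EFin; rewrite !normal_pdfE// [RHS]mulrCA; congr (_ * _).
rewrite /normal_fun -expRD; congr expR.
by field.
Qed.

End normal.

Section iid_integral.
Context d (T : measurableType d) (R : realType).
Local Open Scope ereal_scope.

Lemma ge0_integral_iid0 (P : probability T R) (F : 0.-tuple T -> \bar R) :
  measurable_fun setT F -> \int[iid P 0]_x F x = F [tuple].
Proof. by move=> mF; rewrite integral_dirac// diracT mul1e. Qed.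

Lemma ge0_integral_iidS (P : probability T R) n (F : n.+1.-tuple T -> \bar R) :
  measurable_fun setT F -> (forall x, 0 <= F x) ->
  \int[iid P n.+1]_x F x = \int[P]_a \int[iid P n]_x F (cons_pair (a, x)).
Proof.
move=> mF F0; rewrite /= ge0_integral_distribution//.
rewrite fubini_tonelli1//; last by move=> x; exact: F0.
by apply: measurableT_comp => //; exact: measurable_cons_pair.
Qed.

End iid_integral.

Section cameron_martin.
Variable R : realType.

Definition addt n (h : 'I_n -> R) (w : n.-tuple (measurableTypeR R)) :
    n.-tuple (measurableTypeR R) :=
  [tuple tnth w i + h i | i < n].

Lemma measurable_addt n h : measurable_fun setT (@addt n h).
Proof.
apply/measurable_fun_tnthP => i.
rewrite (_ : _ \o _ = fun w => tnth w i + h i); last first.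
  by apply/funext => w /=; rewrite tnth_mktuple.
by apply: measurable_funD => //; exact: measurable_tnth.
Qed.

Lemma addt_cons n (h : 'I_n.+1 -> R) a x :
  addt h (cons_pair (a, x)) =
  cons_pair (a + h ord0, addt (fun i => h (lift ord0 i)) x).
Proof.
apply: eq_from_tnth => i; rewrite tnth_mktuple.
by case: (unliftP ord0 i) => [j ->|->]; rewrite /cons_pair/= ?tnthS ?tnth_mktuple// !tnth0.
Qed.

(** Density of the Gaussian law with mean [h] and covariance s^2 I with respect to the centred
    one. *)
Definition girsanov n (s : R) (h : 'I_n -> R) (w : n.-tuple (measurableTypeR R)) : R :=
  expR ((\sum_(i < n) (h i * tnth w i - h i ^+ 2 / 2)) / s ^+ 2).

Lemma measurable_girsanov n s h : measurable_fun setT (@girsanov n s h).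
Proof.
apply: measurableT_comp => //; apply: measurable_funM => //.
apply: measurable_sum => i; apply: measurable_funB => //.
by apply: measurable_funM => //; exact: measurable_tnth.
Qed.

Lemma girsanov_cons n s (h : 'I_n.+1 -> R) a x :
  girsanov s h (cons_pair (a, x)) =
  expR ((h ord0 * a - h ord0 ^+ 2 / 2) / s ^+ 2) *
  girsanov s (fun i => h (lift ord0 i)) x.
Proof.
rewrite /girsanov -expRD big_ord_recl mulrDl; congr expR; congr (_ + _ / _).
by apply: eq_bigr => i _; rewrite tnthS.
Qed.

(** Induction on the dimension by Tonelli: the shift acts coordinatewise and the density factors
    ([addt_cons], [girsanov_cons]), so each step is the one-dimensional formula. *)
Lemma iid_normal_shift n (s : R) (h : 'I_n -> R)
    (F : n.-tuple (measurableTypeR R) -> \bar R) : s != 0 ->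
  measurable_fun setT F -> (forall x, 0 <= F x)%E ->
  (\int[iid (normal_prob 0 s) n]_x F (addt h x) =
   \int[iid (normal_prob 0 s) n]_x (F x * (girsanov s h x)%:E))%E.
Proof.
move=> s0; elim: n h F => [|n IHn] h F mF F0.
  rewrite /= !integral_dirac//.
  - by rewrite /girsanov big_ord0 mul0r expR0 mule1; rewrite (tuple0 (addt _ _)) (tuple0 [tuple]).
  - by apply: emeasurable_funM => //; apply/measurable_EFinP; exact: measurable_girsanov.
  - by apply: measurableT_comp => //; exact: measurable_addt.
have mE : measurable_fun setT (fun x => (girsanov s h x)%:E).
  by apply/measurable_EFinP; exact: measurable_girsanov.
have mFE : measurable_fun setT (fun x => F x * (girsanov s h x)%:E)%E.
  exact: emeasurable_funM.
rewrite !ge0_integral_iidS//; last 2 first.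
- by move=> x; rewrite mule_ge0 ?lee_fin ?expR_ge0.
- by apply: measurableT_comp => //; exact: measurable_addt.
pose h' i := h (lift ord0 i).
have mc a : measurable_fun setT (fun x : n.-tuple _ => F (cons_pair (a, x))).
  apply: measurableT_comp => //.
  apply: (measurableT_comp (@measurable_cons_pair _ (measurableTypeR R) n)).
  exact: measurable_pair1.
under eq_integral => a _.
  under eq_integral do rewrite addt_cons.
  rewrite (IHn h' (fun x => F (cons_pair (a + h ord0, x))))//; last exact: mc.
  over.
rewrite (@normal_prob_shift _ s (h ord0) (fun a =>
  \int[iid (normal_prob 0 s) n]_x (F (cons_pair (a, x)) * (girsanov s h' x)%:E))%E)//; last 2 first.
- apply: (measurable_fun_fubini_tonelli_F
    (fun p : measurableTypeR R * n.-tuple _ => F (cons_pair p) * (girsanov s h' p.2)%:E)%E).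
    apply: emeasurable_funM.
      by apply: measurableT_comp => //; exact: measurable_cons_pair.
    apply/measurable_EFinP.
    by apply: (measurableT_comp (measurable_girsanov _ _)).
  by move=> p; rewrite mule_ge0 ?lee_fin ?expR_ge0.
- by move=> a; apply: integral_ge0 => x _; rewrite mule_ge0 ?lee_fin ?expR_ge0.
apply: eq_integral => a _.
rewrite -ge0_integralZr//; last 2 first.
- apply: emeasurable_funM; first exact: mc.
  by apply/measurable_EFinP; exact: measurable_girsanov.
- by move=> x _; rewrite mule_ge0 ?lee_fin ?expR_ge0.
apply: eq_integral => x _.
by rewrite girsanov_cons -muleA -EFinM mulrC.
Qed.

End cameron_martin.


(** * The Rademacher prior and the spiked law *)

Section bernoulli_iid.
Context d (T : measurableType d) (R : realType).
Local Open Scope ereal_scope.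

Lemma big_tuple_bool_S (n : nat) (F : n.+1.-tuple bool -> \bar R) :
  \sum_b F b = \sum_(b : n.-tuple bool) F [tuple of true :: b]
             + \sum_(b : n.-tuple bool) F [tuple of false :: b].
Proof.
rewrite (reindex (fun p : bool * n.-tuple bool => [tuple of p.1 :: p.2])) /=.
  rewrite -(pair_bigA _ (fun a (b : n.-tuple bool) => F [tuple of a :: b])) /=.
  by rewrite big_bool.
exists (fun b => (thead b, [tuple of behead b])) => [[a b] _|b _] /=.
  by congr pair => //; exact: val_inj.
by rewrite [RHS]tuple_eta.
Qed.

(** Turns the Rademacher prior into a uniform average over sign patterns, so that every later
    average over the planted vector is a finite sum. *)
Lemma ge0_integral_iid_bernoulli (g : {mfun bool >-> T}) n
    (F : n.-tuple T -> \bar R) :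
  measurable_fun setT F -> (forall x, 0 <= F x) ->
  \int[iid (distribution (bernoulli_prob 2^-1) g) n]_x F x =
  (2^-1 ^+ n)%:E * \sum_(b : n.-tuple bool) F [tuple of map g b].
Proof.
elim: n F => [|n IHn] F mF F0.
  rewrite ge0_integral_iid0// expr0 mul1e (big_pred1 [tuple]).
    by congr F; exact: val_inj.
  by move=> b; rewrite [b]tuple0 /= eqxx.
have mc a : measurable_fun setT (fun x : n.-tuple _ => F (cons_pair (a, x))).
  apply: measurableT_comp => //.
  apply: (measurableT_comp (@measurable_cons_pair _ T n)).
  exact: measurable_pair1.
rewrite ge0_integral_iidS// ge0_integral_distribution/=; last 2 first.
- apply: (measurable_fun_fubini_tonelli_F (fun p : T * n.-tuple T => F (cons_pair p))) => //.
  by apply: measurableT_comp => //; exact: measurable_cons_pair.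
- by move=> a; exact: integral_ge0.
rewrite integral_bernoulli_prob/=; last 2 first.
- by apply/andP; split; lra.
- by move=> a; exact: integral_ge0.
rewrite !IHn// big_tuple_bool_S exprS ge0_muleDr ?sume_ge0//.
rewrite (_ : unstable.onem 2^-1 = 2^-1 :> R)%R; last by rewrite /unstable.onem; lra.
rewrite EFinM -!muleA; congr (_ * _ + _ * _);
  by congr (_ * _); apply: eq_bigr => b _; congr F; exact: val_inj.
Qed.

End bernoulli_iid.

Section gaussian_mgf.
Variable R : realType.

(** Shifting the constant function 1 shows that [girsanov] has mean 1; multiplying by the
    deterministic factor of the exponential gives the moment generating function. *)
Lemma integral_iid_normal_expR n (s : R) (h : 'I_n -> R) : s != 0 ->
  (\int[iid (normal_prob 0 s) n]_w (expR ((\sum_(i < n) h i * tnth w i) / s ^+ 2))%:E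
   = (expR ((\sum_(i < n) h i ^+ 2) / 2 / s ^+ 2))%:E)%E.
Proof.
move=> s0.
have := @iid_normal_shift _ n s h (cst 1%E) s0 (@measurable_cst _ _ _ _ _ _) (fun=> lee01).
rewrite [X in X = _](_ : _ = 1%E); last first.
  by rewrite integral_cst//= mul1e; exact: probability_setT.
move=> E1; rewrite -[RHS]mule1 [in RHS]E1.
rewrite -ge0_integralZl//; last 2 first.
- apply: emeasurable_funM => //.
  by apply/measurable_EFinP; exact: measurable_girsanov.
- by move=> w _; rewrite mule_ge0 ?lee_fin ?expR_ge0.
apply: eq_integral => w _.
rewrite mul1e -EFinM /girsanov -expRD; congr (expR _)%:E.
rewrite -!mulrDl; congr (_ / _).
rewrite sumrB -mulr_suml; lra.
Qed.

End gaussian_mgf.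

Section spiked_representation.
Variable R : realType.
Local Notation N d n := #|{ffun 'I_d -> 'I_n}|.

Definition noise_sd n : R := Num.sqrt (2 / n%:R).

Definition gauss d n := iid (normal_prob 0 (noise_sd n)) (N d n).

Definition cube n (b : n.-tuple bool) : vec R n :=
  [tuple of map (scaled_sign R n) b].

Definition signal d n lambda (b : n.-tuple bool) (k : 'I_(N d n)) : R :=
  lambda * tnth (tpow d (cube b)) k.

Lemma sum_tensor d n (F : {ffun 'I_d -> 'I_n} -> R) :
  \sum_(k < N d n) F (enum_val k) = \sum_i F i.
Proof.
by rewrite (reindex _ (onW_bij _ (enum_val_bij {ffun 'I_d -> 'I_n}))).
Qed.

(** The d-th power of a sum, expanded by distributivity, is a sum over multi-indices. *)
Lemma inner_tpow d n (x y : vec R n) :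
  \sum_(k < N d n) tnth (tpow d x) k * tnth (tpow d y) k = inner x y ^+ d.
Proof.
under eq_bigr do rewrite !tnth_mktuple.
rewrite (sum_tensor (fun i => (\prod_(k < d) tnth x (i k)) * \prod_(k < d) tnth y (i k))).
under eq_bigr do rewrite -big_split /=.
rewrite -(bigA_distr_bigA (fun (_ : 'I_d) j => tnth x j * tnth y j)).
by rewrite prodr_const card_ord.
Qed.

Lemma mean_perm_const d (c : R) : d`!%:R^-1 * (\sum_(s : 'S_d) c) = c.
Proof.
rewrite sumr_const card_Sn mulrnAr -mulrnAl -[_ *+ _]mulr_natr mulVf ?mul1r//.
Qed.

(** Symmetrization is self-adjoint and fixes tensor powers: for each permutation, reindexing the
    multi-indices leaves the product of coordinates of [x] unchanged. Hence scores do not see it. *)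
Lemma inner_tpow_symmetrize d n (x : vec R n) (w : tensor R d n) :
  \sum_(k < N d n) tnth (tpow d x) k * tnth (symmetrize w) k =
  \sum_(k < N d n) tnth (tpow d x) k * tnth w k.
Proof.
pose P (i : {ffun 'I_d -> 'I_n}) : R := \prod_(k < d) tnth x (i k).
under eq_bigr do rewrite !tnth_mktuple.
rewrite (sum_tensor (fun i => P i * (d`!%:R^-1 * \sum_(s : 'S_d) entry w [ffun k => i (s k)]))).
transitivity (\sum_i P i * entry w i); last first.
  rewrite -(sum_tensor (fun i => P i * entry w i)).
  by apply: eq_bigr => k _; rewrite tnth_mktuple /entry enum_valK.
under eq_bigr do rewrite mulrCA.
rewrite -mulr_sumr.
under eq_bigr do rewrite mulr_sumr.
rewrite exchange_big /=.
rewrite (eq_bigr (fun _ => \sum_i P i * entry w i)) => [|s _].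
  exact: mean_perm_const.
rewrite [RHS](reindex_inj (h := fun i : {ffun 'I_d -> 'I_n} => [ffun k => i (s k)])) /=.
  apply: eq_bigr => i _; congr (_ * _).
  rewrite /P [LHS](reindex_inj (@perm_inj _ s)).
  by apply: eq_bigr => k _; rewrite ffunE.
move=> i j /ffunP ij; apply/ffunP => k.
by have := ij ((s^-1)%g k); rewrite !ffunE permKV.
Qed.

(** The signal is already symmetric, so a spiked observation is the symmetrization of a shifted
    i.i.d. vector, to which the Cameron-Martin formula applies. *)
Lemma symmetrize_addt d n lambda (b : n.-tuple bool) (w : tensor R d n) :
  symmetrize (addt (@signal d n lambda b) w) = spike lambda (cube b, symmetrize w).
Proof.
apply: eq_from_tnth => k; rewrite !tnth_mktuple /= /entry !tnth_mktuple enum_rankK.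
set i := enum_val k; rewrite addrC.
under eq_bigr do rewrite /entry tnth_mktuple /signal tnth_mktuple enum_rankK.
rewrite big_split /= mulrDr; congr (_ + _).
rewrite (eq_bigr (fun _ => lambda * \prod_(l < d) tnth (cube b) (i l))) => [|s _].
  exact: mean_perm_const.
congr (_ * _); rewrite [RHS](reindex_inj (@perm_inj _ s)).
by apply: eq_bigr => l _; rewrite ffunE.
Qed.

Local Open Scope ereal_scope.

Lemma integral_wigner d n (F : tensor R d n -> \bar R) :
  measurable_fun setT F -> (forall x, 0 <= F x) ->
  \int[wigner R d n]_w F w = \int[gauss d n]_w F (symmetrize w).
Proof. by move=> mF F0; rewrite /wigner ge0_integral_distribution. Qed.

Lemma integral_spike_noise d n (F : vec R n * tensor R d n -> \bar R) :
  measurable_fun setT F -> (forall x, 0 <= F x) ->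
  \int[spike_noise (rademacher R) d n]_p F p =
  (2^-1 ^+ n)%:E *
  \sum_(b : n.-tuple bool) \int[gauss d n]_w F (cube b, symmetrize w).
Proof.
move=> mF F0; rewrite /spike_noise fubini_tonelli1// ge0_integral_iid_bernoulli.
- congr (_ * _); apply: eq_bigr => b _; rewrite /fubini_F integral_wigner//.
  by apply: measurableT_comp => //; exact: measurable_pair1.
- exact: measurable_fun_fubini_tonelli_F.
- by move=> x; exact: integral_ge0.
Qed.

Lemma noise_sd_neq0 n : (0 < n)%N -> noise_sd n != 0%R.
Proof.
by move=> n0; rewrite gt_eqF// sqrtr_gt0 divr_gt0// ltr0n.
Qed.

(** Replaces the planted signal by a likelihood weight. [G] also receives the planted vector, so
    that the formula can serve joint functions of signal and observation. *)
Lemma integral_spiked_noise d n lambda (G : vec R n * tensor R d n -> \bar R) :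
  (0 < n)%N -> measurable_fun setT G -> (forall x, 0 <= G x) ->
  \int[spike_noise (rademacher R) d n]_p G (p.1, spike lambda p) =
  (2^-1 ^+ n)%:E * \sum_(b : n.-tuple bool) \int[gauss d n]_w
    (G (cube b, symmetrize w) * (girsanov (noise_sd n) (@signal d n lambda b) w)%:E).
Proof.
move=> n0 mG G0; rewrite integral_spike_noise//; last first.
  apply: measurableT_comp => //; apply: measurable_fun_pair => //.
congr (_ * _); apply: eq_bigr => b _ /=.
rewrite -(@iid_normal_shift _ _ _ _ (fun w => G (cube b, symmetrize w)))//.
- by apply: eq_integral => w _; rewrite symmetrize_addt.
- exact: noise_sd_neq0.
- apply: measurableT_comp => //; apply: measurable_fun_pair => //.
Qed.

End spiked_representation.


(** * Overlaps of cube vectors *)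

Section elementary.
Variable R : realType.

(** From 1 - s <= exp(-s) one gets (1 - s) exp(s) <= 1, while (1 - s)(1 + s + 2 s^2) = 1 + s^2 (1 -
    2 s) is at least 1 for s <= 1/2. *)
Lemma expR_le_quadratic (s : R) : s <= 2^-1 -> expR s <= 1 + s + 2 * s ^+ 2.
Proof.
move=> s2; have s1 : 0 < 1 - s by lra.
have h : 1 - s <= expR (- s) by have := expR_ge1Dx (- s).
have e0 := expR_gt0 s.
have : (1 - s) * expR s <= expR (- s) * expR s by rewrite ler_wpM2r// ltW.
rewrite -expRD addNr expR0.
move=> h1; rewrite -(ler_pM2l s1) (le_trans h1)//.
have -> : (1 - s) * (1 + s + 2 * s ^+ 2) = 1 + s ^+ 2 * (1 - 2 * s) by ring.
by rewrite lerDl mulr_ge0 ?sqr_ge0//; lra.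
Qed.

Lemma cosh_le_gauss (s : R) : `|s| <= 2^-1 ->
  (expR s + expR (- s)) / 2 <= expR (2 * s ^+ 2).
Proof.
rewrite ler_norml => /andP[s1 s2].
have h1 := expR_le_quadratic s2.
have h2 : expR (- s) <= 1 - s + 2 * s ^+ 2.
  by rewrite -[X in 2 * X]sqrrN; apply: expR_le_quadratic; lra.
have := expR_ge1Dx (2 * s ^+ 2); lra.
Qed.

Lemma cube_le_expR (x : R) : 0 <= x -> x ^+ 3 <= 27 * expR x.
Proof.
move=> x0; have h : x / 3 <= expR (x / 3).
  by rewrite (le_trans _ (expR_ge1Dx _))// lerDr.
have -> : expR x = expR (x / 3) ^+ 3.
  by rewrite -expRM_natl; congr expR; field.
have : (x / 3) ^+ 3 <= expR (x / 3) ^+ 3 by rewrite lerXn2r// nnegrE ?expR_ge0//; lra.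
rewrite expr_div_n; have -> : 3 ^+ 3 = 27 :> R by ring.
by lra.
Qed.

Lemma expR_sub1_le (z : R) : expR z - 1 <= z * expR z.
Proof.
have h : 1 - z <= expR (- z) by have := expR_ge1Dx (- z).
have : (1 - z) * expR z <= expR (- z) * expR z.
  by rewrite ler_wpM2r// expR_ge0.
by rewrite -expRD addNr expR0; lra.
Qed.

End elementary.

Section overlap.
Variable R : realType.

Definition disagree n (b b' : n.-tuple bool) : 'I_n -> bool :=
  fun i => tnth b i (+) tnth b' i.

Definition overlap n (b b' : n.-tuple bool) : R :=
  inner (cube R b) (cube R b').

Lemma overlapE n (b b' : n.-tuple bool) : (0 < n)%N ->
  n%:R * overlap b b' = \sum_(i < n) (-1) ^+ (disagree b b' i).
Proof.
move=> n0; rewrite /overlap /inner mulr_sumr; apply: eq_bigr => i _.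
rewrite !tnth_map /scaled_sign /disagree signr_addb.
have s0 : Num.sqrt n%:R != 0 :> R by rewrite gt_eqF// sqrtr_gt0 ltr0n.
have ss : Num.sqrt n%:R ^+ 2 = n%:R :> R by rewrite sqr_sqrtr// ler0n.
rewrite -[X in X * _]ss; field; exact: s0.
Qed.

(** Here [k] is the Hamming distance of the two sign patterns. *)
Lemma overlap_count n (b b' : n.-tuple bool) : (0 < n)%N ->
  exists2 k, (k < n.+1)%N & overlap b b' = 1 - 2 * k%:R / n%:R.
Proof.
move=> n0; exists (\sum_(i < n) disagree b b' i)%N.
  rewrite ltnS -[leqRHS]card_ord -sum1_card leq_sum// => i _.
  by case: disagree.
have n1 : n%:R != 0 :> R by rewrite pnatr_eq0 -lt0n.
apply: (mulfI n1); rewrite overlapE//; set k := (\sum_(i < n) _)%N.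
rewrite (_ : _ * _ = n%:R - 2 * k%:R); last by field.
rewrite -[X in X%:R - _](card_ord n) -sum1_card !natr_sum mulr_sumr -sumrB.
apply: eq_bigr => i _; case: (disagree b b' i); rewrite /= ?expr1 ?expr0; lra.
Qed.

Lemma overlap_le1 n (b b' : n.-tuple bool) : (0 < n)%N -> `|overlap b b'| <= 1.
Proof.
move=> n0; have n1 : 0 < n%:R :> R by rewrite ltr0n.
rewrite -(ler_pM2l n1) mulr1 -[X in X * _]gtr0_norm// -normrM overlapE//.
rewrite (le_trans (ler_norm_sum _ _ _))//.
under eq_bigr do rewrite normr_sign.
by rewrite sumr_const card_ord.
Qed.

(** The signs of [b'] are independent, so the exponential moment factors over coordinates, and each
    factor is the same whatever the sign in [b]. *)
Lemma mean_expR_overlap n (b : n.-tuple bool) (s : R) : (0 < n)%N ->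
  2^-1 ^+ n * \sum_(b' : n.-tuple bool) expR (n%:R * s * overlap b b') =
  ((expR s + expR (- s)) / 2) ^+ n.
Proof.
move=> n0; rewrite (reindex (fun f : {ffun 'I_n -> bool} => [tuple f i | i < n])) /=; last first.
  exists (fun t : n.-tuple bool => [ffun i => tnth t i]) => [f _|t _].
    by apply/ffunP => i; rewrite ffunE tnth_mktuple.
  by apply: eq_from_tnth => i; rewrite tnth_mktuple ffunE.
rewrite (eq_bigr (fun f : {ffun 'I_n -> bool} =>
    \prod_(i < n) expR (s * (-1) ^+ (tnth b i (+) f i)))); last first.
  move=> f _; rewrite -mulrA mulrCA overlapE// mulr_sumr expR_sum.
  by apply: eq_bigr => i _; rewrite /disagree tnth_mktuple.
rewrite -(bigA_distr_bigA (fun i c => expR (s * (-1) ^+ (tnth b i (+) c)))).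
rewrite (eq_bigr (fun _ => expR s + expR (- s))); last first.
  move=> i _; rewrite big_bool; case: (tnth b i) => /=;
  by rewrite expr0 expr1 mulrN1 mulr1// addrC.
by rewrite prodr_const card_ord -exprMn mulrC.
Qed.

(* The overlap takes the values 1 - 2 k / n only, so it is enough to tilt by
   each of these. *)
Lemma mean_expR_overlap_sqr n (b : n.-tuple bool) : (0 < n)%N ->
  2^-1 ^+ n * \sum_(b' : n.-tuple bool) expR (n%:R * overlap b b' ^+ 2 / 8)
  <= n.+1%:R.
Proof.
move=> n0.
have n1 : 0 < n%:R :> R by rewrite ltr0n.
(* For overlap x = 1 - 2k/n, the tilt s = x/4 maximizes s x - 2 s^2, with value x^2/8. The constant
   2 is that of [cosh_le_gauss], so each of the n + 1 tilts contributes at most 1 on average. *)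
pose s (k : nat) : R := (1 - 2 * k%:R / n%:R) / 4.
have le_s b' : expR (n%:R * overlap b b' ^+ 2 / 8) <=
    \sum_(k < n.+1) expR (- 2 * n%:R * s k ^+ 2) * expR (n%:R * s k * overlap b b').
  have [k kn E] := overlap_count b b' n0.
  rewrite (bigD1 (Ordinal kn))//= -expRD {1}E.
  apply: ler_wpDr; first by rewrite sumr_ge0// => i _; rewrite mulr_ge0 ?expR_ge0.
  rewrite ler_expR E /s; rewrite le_eqVlt; apply/orP; left; apply/eqP; field.
  by rewrite gt_eqF.
apply: (@le_trans _ _ (2^-1 ^+ n * \sum_(b' : n.-tuple bool)
    \sum_(k < n.+1) expR (- 2 * n%:R * s k ^+ 2) * expR (n%:R * s k * overlap b b'))).
  by rewrite ler_wpM2l ?exprn_ge0// ler_sum.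
rewrite exchange_big /= mulr_sumr.
apply: (@le_trans _ _ (\sum_(k < n.+1) 1)); last by rewrite sumr_const card_ord.
apply: ler_sum => k _; rewrite -mulr_sumr mulrCA mean_expR_overlap//.
have kn : k%:R <= n%:R :> R by rewrite ler_nat -ltnS ltn_ord.
have k0 : 0 <= k%:R / n%:R :> R by rewrite divr_ge0.
have k1 : k%:R / n%:R <= 1 :> R by rewrite ler_pdivrMr// mul1r.
have sk : `|s k| <= 2^-1 by rewrite ler_norml /s -mulrA; apply/andP; split; lra.
have := cosh_le_gauss sk => h.
apply: (@le_trans _ _ (expR (- 2 * n%:R * s k ^+ 2) * expR (2 * s k ^+ 2) ^+ n)).
  rewrite ler_wpM2l ?expR_ge0// lerXn2r// nnegrE ?expR_ge0//.
rewrite -expRM_natl -expRD (_ : _ + _ = 0) ?expR0//; ring.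
Qed.

(* Near overlap 1 the limit exponent is a / 2 - ln 2 < 0. *)
Lemma tail_parameters (a : R) : a < 2 * ln 2 ->
  exists s t : R, [/\ 0 <= s, 0 <= t < 1 &
    expR (a / 2) * (expR (- (s * t)) * ((expR s + expR (- s)) / 2)) < 1].
Proof.
move=> a2; pose e := ln 2 - a / 2.
have e0 : 0 < e by rewrite /e; lra.
(* Since s > 2/e, exp(-s) < 1/(1 + s) < e/2; since s > e, [u] is below 1. The choice of [u] makes
   the loss s u from taking t = 1 - u equal to half of the gap [e]. *)
pose s := 2 / e + e; have s0 : 0 < s by rewrite addr_gt0// divr_gt0.
have se : e < s by rewrite ltrDr divr_gt0.
pose u := e / (2 * s).
have u0 : 0 < u by rewrite divr_gt0// mulr_gt0.
have u1 : u < 1 by rewrite ltr_pdivrMr ?mulr_gt0//; lra.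
exists s, (1 - u); split; [lra|lra|].
have su : s * u = e / 2 by rewrite /u; field; rewrite gt_eqF.
have -> : a / 2 = ln 2 - e by rewrite /e; lra.
have -> : expR (ln 2 - e) * (expR (- (s * (1 - u))) * ((expR s + expR (- s)) / 2)) =
    expR (- e) * (expR (e / 2) + expR (- s - (s - e / 2))).
  rewrite expRD lnK ?posrE//.
  have -> : - (s * (1 - u)) = e / 2 - s by rewrite -su; ring.
  have -> : expR (e / 2) = expR (e / 2 - s) * expR s by rewrite -expRD subrK.
  have -> : expR (- s - (s - e / 2)) = expR (e / 2 - s) * expR (- s).
    by rewrite -expRD; congr expR; ring.
  by field.
(* What remains is exp(e/2) + exp(-2s + e/2) < exp(e): the second term is below e/2, and
   exp(e/2)(exp(e/2) - 1) >= e/2. *)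
have E1 : 1 = expR (- e) * expR e by rewrite -expRD addNr expR0.
rewrite [ltRHS]E1.
rewrite ltr_pM2l ?expR_gt0//.
have h1 : expR (- s - (s - e / 2)) <= expR (- s) by rewrite ler_expR; lra.
have h2 : expR (- s) < e / 2.
  have := expR_gt1Dx (lt0r_neq0 s0) => hs.
  rewrite expRN -[ltRHS]invrK ltf_pV2 ?posrE ?expR_gt0 ?invr_gt0 ?divr_gt0//.
  rewrite invf_div; apply: lt_trans hs; rewrite /s; lra.
have h3 : 1 + e / 2 <= expR (e / 2) by exact: expR_ge1Dx.
have -> : expR e = expR (e / 2) * expR (e / 2) by rewrite -expRD; congr expR; lra.
have : 0 <= (expR (e / 2) - 1) * (expR (e / 2) - 1 - e / 2).
  by apply: mulr_ge0; lra.
nra.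
Qed.

(* With G the exponential, this dominates both G - 1 (detection) and r G
   (recovery). *)
Definition second_moment_excess d n (a : R) (b b' : n.-tuple bool) : R :=
  let r := Num.max 0 (overlap b b' ^+ d) in
  (1 + r) * expR (n%:R * a * (r / (1 + r))) - 1.

(** Each summand handles one range of the overlap x. For |x| > t, r/(1+r) <= 1/2 caps the exponent
    at n a/2, and the Chernoff factor exp(n s (|x| - t)) >= 1 pays for the restriction. For |x| <=
    t, the bound on a t^(d-2) keeps the exponent below n x^2/16, and r <= |x|^6 gives a factor n^-2,
    enough to beat the n + 1 of [mean_expR_overlap_sqr]. *)
Lemma second_moment_excess_le (a s t : R) d n (b b' : n.-tuple bool) :
  0 <= a -> 0 <= s -> 0 <= t < 1 -> (6 <= d)%N -> a * t ^+ (d - 2) <= 16^-1 ->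
  (0 < n)%N ->
  second_moment_excess d a b b' <=
    (a + 1) * 48 ^+ 3 / n%:R ^+ 2 * expR (n%:R * overlap b b' ^+ 2 / 8) +
    2 * expR (a / 2) ^+ n * expR (- (s * t)) ^+ n *
      (expR (n%:R * s * overlap b b') + expR (n%:R * (- s) * overlap b b')).
Proof.
move=> a0 s0 /andP[t0 t1] d6 at16 n0.
have n1 : 0 < n%:R :> R by rewrite ltr0n.
have n1' : 1 <= n%:R :> R by rewrite ler1n.
have x1 := @overlap_le1 n b b' n0.
rewrite /second_moment_excess; set x := overlap b b' in x1 *.
set r := Num.max _ _; have r0 : 0 <= r by rewrite le_max lexx.
have rle : r <= `|x| ^+ d.
  by rewrite /r ge_max exprn_ge0//= -normrX ler_norm.
have r1 : r <= 1 by rewrite (le_trans rle)// exprn_ile1.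
have rr : r / (1 + r) <= r by rewrite ler_pdivrMr; nra.
have rr2 : r / (1 + r) <= 2^-1 by rewrite ler_pdivrMr; nra.
set z := n%:R * a * _.
have na : 0 <= n%:R * a by rewrite mulr_ge0// ltW.
have z0 : 0 <= z by rewrite mulr_ge0// divr_ge0//; lra.
have T1 : 0 <= (a + 1) * 48 ^+ 3 / n%:R ^+ 2 * expR (n%:R * x ^+ 2 / 8).
  by rewrite mulr_ge0 ?expR_ge0// divr_ge0 ?exprn_ge0//; lra.
have T2 : 0 <= 2 * expR (a / 2) ^+ n * expR (- (s * t)) ^+ n *
      (expR (n%:R * s * x) + expR (n%:R * (- s) * x)).
  by rewrite !mulr_ge0 ?exprn_ge0 ?addr_ge0 ?expR_ge0.
have [xt|xt] := leP `|x| t; last first.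
  apply: ler_wpDl => //.
  have ez : expR z <= expR (a / 2) ^+ n.
    rewrite -expRM_natl ler_expR /z -mulrA ler_wpM2l ?(ltW n1)//.
    by rewrite ler_wpM2l.
  have e2 : 1 <= expR (- (s * t)) ^+ n * (expR (n%:R * s * x) + expR (n%:R * (- s) * x)).
    apply: (@le_trans _ _ (expR (- (s * t)) ^+ n * expR (n%:R * s * `|x|))).
      rewrite -expRM_natl -expRD leNgt expR_lt1 -leNgt.
      have -> : n%:R * - (s * t) + n%:R * s * `|x| = n%:R * s * (`|x| - t) by ring.
      by rewrite !mulr_ge0 ?(ltW n1)// subr_ge0 ltW.
    rewrite ler_wpM2l ?exprn_ge0 ?expR_ge0//.
    have [x0|x0] := leP 0 x; first by rewrite ger0_norm// lerDl expR_ge0.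
    by rewrite ltr0_norm// mulrN -mulNr -[- (_ * s)]mulrN lerDr expR_ge0.
  rewrite -[leRHS]mulrA.
  apply: (@le_trans _ _ (2 * expR (a / 2) ^+ n)); last first.
    by rewrite ler_peMr// mulr_ge0 ?exprn_ge0 ?expR_ge0.
  have := expR_ge0 z; nra.
apply: ler_wpDr => //.
set y := n%:R * x ^+ 2.
have y0 : 0 <= y by rewrite mulr_ge0 ?sqr_ge0// ltW.
have r6 : r <= `|x| ^+ 6.
  rewrite (le_trans rle)//; apply: ler_wiXn2l => //.
have r2 : a * r <= x ^+ 2 / 16.
  rewrite -(real_normK (num_real x)).
  have : a * r <= a * (`|x| ^+ 2 * t ^+ (d - 2)).
    rewrite ler_wpM2l// (le_trans rle)// -{1}(subnKC (leq_trans _ d6 : (2 <= d)%N))// exprD.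
    by rewrite ler_wpM2l ?exprn_ge0// lerXn2r// nnegrE.
  move/le_trans; apply; rewrite mulrCA ler_wpM2l ?exprn_ge0//.
have zr : z <= n%:R * (a * r) by rewrite /z -mulrA !ler_wpM2l// ltW.
have zy : z <= y / 16.
  rewrite (le_trans zr)// /y -mulrA ler_wpM2l// ltW//.
have x6 : `|x| ^+ 6 = y ^+ 3 / n%:R ^+ 3.
  rewrite /y (_ : 6 = 2 * 3)%N// exprM (real_normK (num_real x)); field.
  by rewrite gt_eqF.
(* The budget exp(y/8) is split in two halves: one absorbs y^3, with 48 = 3 * 16 from
   [cube_le_expR], the other exp(z). *)
have y3 : y ^+ 3 <= 48 ^+ 3 * expR (y / 16).
  have := @cube_le_expR R (y / 16); rewrite divr_ge0// => /(_ isT).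
  rewrite expr_div_n (_ : 16 ^+ 3 = 4096 :> R); last by ring.
  lra.
have main : (1 + r) * expR z - 1 <= (a + 1) / n%:R ^+ 2 * y ^+ 3 * expR z.
  have e1 := expR_sub1_le z; have ez := expR_ge0 z.
  apply: (@le_trans _ _ ((z + r) * expR z)); first by lra.
  rewrite ler_wpM2r//.
  apply: (@le_trans _ _ ((a + 1) * (n%:R * `|x| ^+ 6))).
    rewrite mulrDl mul1r lerD//.
      rewrite (le_trans zr)// mulrCA ler_wpM2l// ler_wpM2l// ltW//.
    by rewrite (le_trans r6)// ler_peMl// exprn_ge0.
  rewrite x6 -mulrA ler_wpM2l ?addr_ge0//.
  rewrite le_eqVlt; apply/orP; left; apply/eqP; field.
  by rewrite gt_eqF.
apply: (le_trans main).
have c0 : 0 <= (a + 1) / n%:R ^+ 2 by rewrite divr_ge0 ?addr_ge0 ?exprn_ge0// ltW.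
have -> : y / 8 = y / 16 + y / 16 by lra.
rewrite expRD.
have ez : expR z <= expR (y / 16) by rewrite ler_expR.
apply: (@le_trans _ _ ((a + 1) / n%:R ^+ 2 * (48 ^+ 3 * expR (y / 16)) * expR (y / 16))).
  apply: ler_pM => //; last by rewrite ler_wpM2l.
  by apply: mulr_ge0 => //; exact: exprn_ge0.
rewrite le_eqVlt; apply/orP; left; apply/eqP; field.
by rewrite gt_eqF.
Qed.

(** The parameters [s] and [t] depend on [a] only, so a large [d] makes a t^(d-2) small. After
    averaging, the first summand is of order 1/n and the second decays geometrically by
    [tail_parameters]. *)
Lemma mean_second_moment_excess (a : R) : 0 <= a -> a < 2 * ln 2 ->
  \forall d \near \oo, forall e : R, 0 < e ->
  \forall n \near \oo, forall b : n.-tuple bool,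
    2^-1 ^+ n * \sum_(b' : n.-tuple bool) second_moment_excess d a b b' <= e.
Proof.
move=> a0 a2; have [s [t [s0 t01 st]]] := tail_parameters a2.
have /andP[t0 t1] := t01.
set th := expR (a / 2) * _ in st.
have th0 : 0 <= th.
  by rewrite !mulr_ge0 ?expR_ge0// addr_ge0 ?expR_ge0.
have cvgt : a * t ^+ n @[n --> \oo] --> a * 0.
  by apply: cvgM; [exact: cvg_cst|apply: cvg_expr]; rewrite ger0_norm.
have {cvgt} nt : \forall n \near \oo, a * t ^+ n <= 16^-1.
  by apply: (cvgr_le _ cvgt); rewrite mulr0; lra.
case: nt => D _ hD; exists (D + 6)%N => // d /= Dd e e0.
have at16 : a * t ^+ (d - 2) <= 16^-1 by apply: hD; rewrite /= leq_subRL; lia.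
(* The bound (n+1)/n^2 <= 4/(n+1) accounts for the two factors 2 next to (a + 1) 48^3; in 4 th^n,
   one factor 2 comes from the pointwise bound and one from the two tilts s and -s. *)
pose C : R := (a + 1) * 48 ^+ 3 * 2.
have cvgu : C * n.+1%:R^-1 * 2 + 4 * th ^+ n @[n --> \oo] --> C * 0 * 2 + 4 * 0.
  apply: cvgD; last by apply: cvgM; [exact: cvg_cst|apply: cvg_expr]; rewrite ger0_norm.
  by apply: cvgM; [apply: cvgM; [exact: cvg_cst|exact: cvg_harmonic]|exact: cvg_cst].
have : \forall n \near \oo, C * n.+1%:R^-1 * 2 + 4 * th ^+ n <= e.
  by apply: (cvgr_le _ cvgu); rewrite !mulr0 mul0r addr0.
case=> M _ hM; exists M.+1 => // n /= Mn b.
have n0 : (0 < n)%N by exact: leq_ltn_trans Mn.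
have n1 : 0 < n%:R :> R by rewrite ltr0n.
have n1' : 1 <= n%:R :> R by rewrite ler1n.
apply: le_trans (hM n _); last exact: ltnW.
apply: (@le_trans _ _ (2^-1 ^+ n * \sum_(b' : n.-tuple bool)
   ((a + 1) * 48 ^+ 3 / n%:R ^+ 2 * expR (n%:R * overlap b b' ^+ 2 / 8) +
    2 * expR (a / 2) ^+ n * expR (- (s * t)) ^+ n *
      (expR (n%:R * s * overlap b b') + expR (n%:R * (- s) * overlap b b'))))).
  rewrite ler_wpM2l ?exprn_ge0// ler_sum// => b' _.
  by apply: second_moment_excess_le => //; exact: leq_trans (leq_addl _ _) Dd.
rewrite big_split /= -!mulr_sumr big_split /= mulrDr; apply: lerD.
  rewrite mulrCA.
  have c0 : 0 <= (a + 1) * 48 ^+ 3 by rewrite mulr_ge0 ?exprn_ge0 ?addr_ge0.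
  have hn : n.+1%:R / n%:R ^+ 2 <= 4 / n.+1%:R :> R.
    rewrite ler_pdivrMr ?exprn_gt0// mulrAC ler_pdivlMr ?ltr0n// -natr1; nra.
  apply: (@le_trans _ _ ((a + 1) * 48 ^+ 3 / n%:R ^+ 2 * n.+1%:R)).
    by rewrite ler_wpM2l ?mean_expR_overlap_sqr// divr_ge0 ?exprn_ge0// ltW.
  rewrite -mulrA [_^-1 * _]mulrC (le_trans (ler_wpM2l c0 hn))//.
  by rewrite /C le_eqVlt; apply/orP; left; apply/eqP; ring.
rewrite mulrCA mulrDr !mean_expR_overlap// opprK [expR (- s) + _]addrC.
rewrite /th !exprMn; set c := expR _ ^+ _; set g := expR _ ^+ _; set k := _ ^+ n.
by rewrite le_eqVlt; apply/orP; left; apply/eqP; ring.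
Qed.

End overlap.


(** * Truncated likelihood ratios *)

Lemma bounded_ereal (R : realType) (x : \bar R) (r : R) :
  (0 <= x)%E -> (x <= r%:E)%E -> exists2 s, x = s%:E & s <= r.
Proof. by case: x => [s| |]// _; rewrite lee_fin => sr; exists s. Qed.

Section gaussian_expectation.
Variable R : realType.
Local Notation N d n := #|{ffun 'I_d -> 'I_n}|.
Local Open Scope ereal_scope.

(** Null expectation taken before symmetrization. Its values are extended reals, so only
    nonnegativity and measurability have to be tracked. *)
Definition gmean d n (f : tensor R d n -> R) : \bar R :=
  \int[gauss R d n]_w (f w)%:E.

Lemma gmean_ge0 d n (f : tensor R d n -> R) :
  (forall w, (0 <= f w)%R) -> 0 <= gmean f.
Proof. by move=> f0; apply: integral_ge0 => w _; rewrite lee_fin. Qed.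

Lemma gmeanD d n (f g : tensor R d n -> R) :
  measurable_fun setT f -> measurable_fun setT g ->
  (forall w, (0 <= f w)%R) -> (forall w, (0 <= g w)%R) ->
  gmean (fun w => f w + g w)%R = gmean f + gmean g.
Proof.
move=> mf mg f0 g0; rewrite /gmean -ge0_integralD//.
- by move=> w _; rewrite lee_fin.
- exact/measurable_EFinP.
- by move=> w _; rewrite lee_fin.
- exact/measurable_EFinP.
Qed.

Lemma gmeanZ d n (k : R) (f : tensor R d n -> R) :
  measurable_fun setT f -> (forall w, (0 <= f w)%R) -> (0 <= k)%R ->
  gmean (fun w => k * f w)%R = k%:E * gmean f.
Proof.
move=> mf f0 k0; rewrite /gmean -ge0_integralZl//.
- exact/measurable_EFinP.
- by move=> w _; rewrite lee_fin.
Qed.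

Lemma gmean_cst d n (c : R) : gmean (fun _ : tensor R d n => c) = c%:E.
Proof. by rewrite /gmean integral_cst//= [X in _ * X](@probability_setT _ _ _ (gauss R d n)) mule1. Qed.

Lemma gmean_sum d n (I : finType) (f : I -> tensor R d n -> R) :
  (forall i, measurable_fun setT (f i)) -> (forall i w, (0 <= f i w)%R) ->
  gmean (fun w => \sum_i f i w)%R = \sum_i gmean (f i).
Proof.
move=> mf f0; rewrite /gmean -ge0_integral_sum//.
- by apply: eq_integral => w _; rewrite sumEFin.
- by move=> i; exact/measurable_EFinP.
- by move=> i w _; rewrite lee_fin.
Qed.

Lemma le_gmean d n (f g : tensor R d n -> R) :
  measurable_fun setT f -> measurable_fun setT g ->
  (forall w, (0 <= f w)%R) -> (forall w, (f w <= g w)%R) ->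
  gmean f <= gmean g.
Proof.
move=> mf mg f0 fg; apply: ge0_le_integral => //.
- by move=> w _; rewrite lee_fin.
- exact/measurable_EFinP.
- exact/measurable_EFinP.
- by move=> w _; rewrite lee_fin.
Qed.

(** Common form of all the Chernoff bounds below: [h] is the tilt, [c] the deterministic cost, and
    2/n the noise variance. *)
Lemma gmean_expR d n (h : 'I_(N d n) -> R) (c : R) : (0 < n)%N ->
  gmean (fun w => expR ((\sum_k h k * tnth w k + c) / (2 / n%:R)))%R =
  (expR (((\sum_k h k ^+ 2) / 2 + c) / (2 / n%:R)))%:E.
Proof.
move=> n0.
have E := @integral_iid_normal_expR R _ _ h (noise_sd_neq0 R n0).
have s2 : (noise_sd R n ^+ 2 = 2 / n%:R)%R by rewrite sqr_sqrtr// divr_ge0.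
rewrite s2 in E.
have -> : gmean (fun w => expR ((\sum_k h k * tnth w k + c) / (2 / n%:R)))%R =
  gmean (fun w : tensor R d n => expR (c / (2 / n%:R)) * expR ((\sum_k h k * tnth w k) / (2 / n%:R)))%R.
  by apply: eq_integral => w _; rewrite -expRD addrC -mulrDl.
rewrite gmeanZ ?expR_ge0//.
- by rewrite {1}/gmean [X in _ * X]E -EFinM -expRD -mulrDl addrC.
- apply: measurableT_comp => //; apply: measurable_funM => //.
  apply: measurable_sum => k; apply: measurable_funM => //; exact: measurable_tnth.
Qed.

End gaussian_expectation.

Section truncated_likelihood.
Variables (R : realType) (d n : nat) (lambda delta : R).
Hypotheses (n0 : (0 < n)%N) (lambda0 : 0 <= lambda) (delta0 : 0 <= delta).
Local Notation N := #|{ffun 'I_d -> 'I_n}|.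
Implicit Types (b : n.-tuple bool) (w : tensor R d n).

Definition score b w : R :=
  \sum_(k < N) tnth (tpow d (cube R b)) k * tnth w k.

Lemma measurable_score b : measurable_fun setT (score b).
Proof.
apply: measurable_sum => k; apply: measurable_funM => //; exact: measurable_tnth.
Qed.

Lemma inner_cube b : inner (cube R b) (cube R b) = 1.
Proof.
have [k kn E] := @overlap_count R n b b n0.
rewrite -[LHS]/(overlap R b b); apply: (mulfI (_ : n%:R != 0 :> R)).
  by rewrite pnatr_eq0 -lt0n.
rewrite overlapE// mulr1 /disagree.
under eq_bigr do rewrite addbb expr0.
by rewrite sumr_const card_ord.
Qed.

(** Cauchy-Schwarz for unit vectors, from the nonnegativity of the squared norms of x + z and x -
    z. *)
Lemma inner_cube_le1 b (z : vec R n) :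
  inner z z = 1 -> `|inner (cube R b) z ^+ d| <= 1.
Proof.
move=> z1; rewrite normrX exprn_ile1//.
have q (s : R) : s ^+ 2 = 1 -> 0 <= 1 + s * inner (cube R b) z.
  move=> s1.
  have : 0 <= \sum_i (tnth (cube R b) i + s * tnth z i) ^+ 2.
    by rewrite sumr_ge0// => i _; exact: sqr_ge0.
  have -> : \sum_i (tnth (cube R b) i + s * tnth z i) ^+ 2 =
    inner (cube R b) (cube R b) + s ^+ 2 * inner z z + 2 * (s * inner (cube R b) z).
    by rewrite /inner !mulr_sumr -!big_split /=; apply: eq_bigr => i _; ring.
  rewrite inner_cube z1 s1; lra.
have := q 1 (expr1n _ _); have := q (-1) (etrans (sqrrN 1) (expr1n _ _)).
by rewrite ler_norml => ? ?; apply/andP; split; lra.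
Qed.

Definition likelihood b w : R := girsanov (noise_sd R n) (@signal R d n lambda b) w.

(** The tensor power of a cube vector has norm 1, so the likelihood ratio depends on [w] only
    through the score. *)
Lemma likelihoodE b w :
  likelihood b w = expR ((lambda * score b w - lambda ^+ 2 / 2) / (2 / n%:R)).
Proof.
have s2 : noise_sd R n ^+ 2 = 2 / n%:R by rewrite /noise_sd sqr_sqrtr// divr_ge0.
have -> : lambda * score b w - lambda ^+ 2 / 2 =
    \sum_(i < N) (signal lambda b i * tnth w i - signal lambda b i ^+ 2 / 2).
  rewrite sumrB mulr_sumr; congr (_ - _).
    by apply: eq_bigr => k _; rewrite /signal mulrA.
  rewrite -mulr_suml.
  under eq_bigr do rewrite /signal exprMn [X in _ * X]expr2.
  by rewrite -mulr_sumr inner_tpow inner_cube expr1n mulr1.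
by rewrite /likelihood /girsanov s2.
Qed.

Lemma likelihood_ge0 b w : 0 <= likelihood b w.
Proof. exact: expR_ge0. Qed.

Lemma measurable_likelihood b : measurable_fun setT (likelihood b).
Proof. exact: measurable_girsanov. Qed.

Definition truncated b w : R :=
  if score b w <= lambda + delta then likelihood b w else 0.

Definition excess b w : R :=
  if score b w <= lambda + delta then 0 else likelihood b w.

Lemma likelihood_split b w : likelihood b w = truncated b w + excess b w.
Proof. by rewrite /truncated /excess; case: ifP; rewrite ?addr0 ?add0r. Qed.

Lemma truncated_ge0 b w : 0 <= truncated b w.
Proof. by rewrite /truncated; case: ifP => // _; exact: likelihood_ge0. Qed.

Lemma excess_ge0 b w : 0 <= excess b w.
Proof. by rewrite /excess; case: ifP => // _; exact: likelihood_ge0. Qed.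

Lemma measurable_truncated b : measurable_fun setT (truncated b).
Proof.
apply: measurable_fun_ifT => //; last exact: measurable_likelihood.
by apply: measurable_fun_ler => //; exact: measurable_score.
Qed.

Lemma measurable_excess b : measurable_fun setT (excess b).
Proof.
apply: measurable_fun_ifT => //; last exact: measurable_likelihood.
by apply: measurable_fun_ler => //; exact: measurable_score.
Qed.

Local Notation eta := (expR (- (n%:R * delta ^+ 2 / 4))).

Lemma gmean_likelihood b : gmean (likelihood b) = 1%E.
Proof.
have := @gmean_expR R d n (@signal R d n lambda b) (- (lambda ^+ 2 / 2)) n0.
under [X in gmean X]eq_fun.
  move=> w.
  rewrite (_ : \sum_k _ = lambda * score b w); last first.
    by rewrite mulr_sumr; apply: eq_bigr => k _; rewrite /signal mulrA.
  rewrite -likelihoodE; over.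
move=> ->; congr (_%:E); rewrite -(expR0 R); congr expR.
under eq_bigr do rewrite /signal exprMn [X in _ * X]expr2.
by rewrite -mulr_sumr inner_tpow inner_cube expr1n mulr1 subrr mul0r.
Qed.

(** Under the planted law the score is Gaussian with mean [lambda] and variance 2/n, and [eta] is
    the Chernoff bound for exceeding its mean by [delta]. *)
Lemma gmean_excess b : (gmean (excess b) <= eta%:E)%E.
Proof.
pose h k := (lambda + delta) * tnth (tpow d (cube R b)) k.
(* With this [c] the exponent is that of the likelihood plus delta (score - lambda - delta), which
   is positive or zero on the excess event. *)
pose c := - (lambda ^+ 2 / 2) - delta * (lambda + delta).
have sh w : \sum_k h k * tnth w k = (lambda + delta) * score b w.
  by rewrite mulr_sumr; apply: eq_bigr => k _; rewrite /h mulrA.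
have n1 : 0 < n%:R :> R by rewrite ltr0n.
have i0 : 0 <= (2 / n%:R : R)^-1 by rewrite invr_ge0 divr_ge0.
have h2 : \sum_k h k ^+ 2 = (lambda + delta) ^+ 2.
  under eq_bigr do rewrite /h exprMn [X in _ * X]expr2.
  by rewrite -mulr_sumr inner_tpow inner_cube expr1n mulr1.
have -> : eta = expR (((\sum_k h k ^+ 2) / 2 + c) / (2 / n%:R)).
  by rewrite h2 /c; congr expR; field; rewrite gt_eqF.
rewrite -gmean_expR//; apply: le_gmean.
- exact: measurable_excess.
- apply: measurableT_comp => //; apply: measurable_funM => //.
  apply: measurable_funD => //.
  apply: measurable_sum => k; apply: measurable_funM => //; exact: measurable_tnth.
- exact: excess_ge0.
- move=> w; rewrite /excess sh; case: ifPn => [_|]; first exact: expR_ge0.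
  rewrite -ltNge => su; rewrite likelihoodE ler_expR ler_wpM2r// /c.
  have : 0 <= delta * (score b w - (lambda + delta)) by rewrite mulr_ge0// subr_ge0 ltW.
  lra.
Qed.

Lemma gmean_truncated b : ((1 - eta)%:E <= gmean (truncated b))%E.
Proof.
have := gmean_likelihood b.
rewrite (_ : likelihood b = fun w => truncated b w + excess b w); last first.
  by apply/funext => w; exact: likelihood_split.
rewrite gmeanD; first last.
- exact: excess_ge0.
- exact: truncated_ge0.
- exact: measurable_excess.
- exact: measurable_truncated.
have := gmean_excess b; have := gmean_ge0 (excess_ge0 b).
have := gmean_ge0 (truncated_ge0 b).
case: (gmean (truncated b)) => [t| |]//; case: (gmean (excess b)) => [x| |]//.
rewrite !lee_fin -EFinD => _ _ xe [tx]; lra.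
Qed.

Definition overlap_pos b b' : R := Num.max 0 (overlap R b b' ^+ d).

(* On the event that both scores are at most lambda + delta, tilting both
   likelihoods down to lambda / (1 + r) is an upper bound; this value of the
   tilt is the one for which the tilted scores have mean lambda. *)
Lemma gmean_truncated_pair (a : R) b b' :
  a = (lambda ^+ 2 + 2 * lambda * delta) / 2 ->
  (gmean (fun w => truncated b w * truncated b' w)%R <=
   (expR (n%:R * a * (overlap_pos b b' / (1 + overlap_pos b b'))))%:E)%E.
Proof.
move=> aE; set r := overlap_pos b b'.
have r0 : 0 <= r by rewrite le_max lexx.
have rr : overlap R b b' ^+ d <= r by rewrite le_max lexx orbT.
have r1 : 0 < 1 + r by lra.
pose th := lambda / (1 + r).
have th0 : 0 <= th by rewrite divr_ge0// ltW.
have thl : th <= lambda by rewrite ler_pdivrMr// ler_peMr//; lra.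
have thr : th * (1 + r) = lambda by rewrite divfK// gt_eqF.
pose h k := th * tnth (tpow d (cube R b)) k + th * tnth (tpow d (cube R b')) k.
(* On the event, the part (lambda - th) of both tilts is replaced by its largest value, where the
   scores sum to 2 lambda + 2 delta. *)
pose c := (lambda - th) * (2 * lambda + 2 * delta) - lambda ^+ 2.
have sh w : \sum_k h k * tnth w k = th * score b w + th * score b' w.
  by rewrite !mulr_sumr -big_split; apply: eq_bigr => k _; rewrite /h /= mulrDl !mulrA.
have n1 : 0 < n%:R :> R by rewrite ltr0n.
have i0 : 0 <= (2 / n%:R : R)^-1 by rewrite invr_ge0 divr_ge0.
have h2 : \sum_k h k ^+ 2 = 2 * th ^+ 2 * (1 + overlap R b b' ^+ d).
  have e b1 b2 : \sum_(k < N) tnth (tpow d (cube R b1)) k * tnth (tpow d (cube R b2)) k = overlap R b1 b2 ^+ d.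
    exact: inner_tpow.
  have e1 b1 : overlap R b1 b1 ^+ d = 1 by rewrite /overlap inner_cube expr1n.
  transitivity (th ^+ 2 * (overlap R b b ^+ d + overlap R b' b' ^+ d + 2 * overlap R b b' ^+ d)).
    rewrite -!e mulr_sumr -!big_split mulr_sumr /=; apply: eq_bigr => k _.
    rewrite /h; ring.
  by rewrite !e1; ring.
apply: (@le_trans _ _ (expR (((\sum_k h k ^+ 2) / 2 + c) / (2 / n%:R)))%:E); last first.
  rewrite lee_fin ler_expR h2.
  have -> : n%:R * a * (r / (1 + r)) = a * (r / (1 + r)) * 2 / (2 / n%:R).
    by field; rewrite !gt_eqF.
  rewrite ler_wpM2r// /c.
  have lr : lambda - th = th * r by lra.
  have ar : a * (r / (1 + r)) * 2 = (lambda + 2 * delta) * (th * r).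
    by rewrite aE /th; field; rewrite gt_eqF.
  rewrite ar lr.
  have : th ^+ 2 * (1 + overlap R b b' ^+ d) <= th ^+ 2 * (1 + r).
    by rewrite ler_wpM2l ?sqr_ge0//; lra.
  have -> : th ^+ 2 * (1 + r) = th * lambda by rewrite expr2 -mulrA thr.
  have : lambda ^+ 2 = lambda * (th * (1 + r)) by rewrite thr expr2.
  by lra.
rewrite -gmean_expR//; apply: le_gmean.
- by apply: measurable_funM; exact: measurable_truncated.
- apply: measurableT_comp => //; apply: measurable_funM => //.
  apply: measurable_funD => //.
  apply: measurable_sum => k; apply: measurable_funM => //; exact: measurable_tnth.
- by move=> w; rewrite mulr_ge0// truncated_ge0.
- move=> w; rewrite /truncated sh.
  case: ifPn => [s1|_]; last by rewrite mul0r expR_ge0.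
  case: ifPn => [s2|_]; last by rewrite mulr0 expR_ge0.
  rewrite !likelihoodE -expRD ler_expR -mulrDl ler_wpM2r// /c.
  have : 0 <= (lambda - th) * (2 * lambda + 2 * delta - score b w - score b' w).
    by rewrite mulr_ge0//; lra.
  lra.
Qed.

Lemma mean_cst (c : R) : 2^-1 ^+ n * (\sum_(b : n.-tuple bool) c) = c.
Proof.
rewrite sumr_const card_tuple card_bool mulrnAr -mulrnAl.
by rewrite -[(_ ^+ n) *+ _]mulr_natr natrX -exprMn mulVf// expr1n mul1r.
Qed.

Lemma mean_le_e (f : n.-tuple bool -> \bar R) (c : R) :
  (forall b, f b <= c%:E)%E -> ((2^-1 ^+ n)%:E * \sum_b f b <= c%:E)%E.
Proof.
move=> fc; rewrite -[in leRHS](mean_cst c) EFinM -sumEFin.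
by rewrite lee_wpmul2l ?lee_fin ?exprn_ge0//; apply: lee_sum => b _.
Qed.

Lemma mean_ge_e (f : n.-tuple bool -> \bar R) (c : R) :
  (forall b, c%:E <= f b)%E -> (c%:E <= (2^-1 ^+ n)%:E * \sum_b f b)%E.
Proof.
move=> fc; rewrite -[in leLHS](mean_cst c) EFinM -sumEFin.
by rewrite lee_wpmul2l ?lee_fin ?exprn_ge0//; apply: lee_sum => b _.
Qed.

Definition mean (f : n.-tuple bool -> tensor R d n -> R) w : R :=
  2^-1 ^+ n * \sum_b f b w.

Lemma measurable_mean f :
  (forall b, measurable_fun setT (f b)) -> measurable_fun setT (mean f).
Proof. by move=> mf; apply: measurable_funM => //; exact: measurable_sum. Qed.

Lemma mean_ge0 f : (forall b w, 0 <= f b w) -> forall w, 0 <= mean f w.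
Proof. by move=> f0 w; rewrite mulr_ge0 ?exprn_ge0// sumr_ge0. Qed.

Lemma gmean_mean (f : n.-tuple bool -> tensor R d n -> R) : (forall b, measurable_fun setT (f b)) ->
  (forall b w, 0 <= f b w) ->
  gmean (mean f) = ((2^-1 ^+ n)%:E * \sum_b gmean (f b))%E.
Proof.
move=> mf f0; rewrite gmeanZ ?exprn_ge0//.
- by rewrite gmean_sum.
- exact: measurable_sum.
- by move=> w; rewrite sumr_ge0.
Qed.

Lemma gmean_mean_likelihood : gmean (mean likelihood) = 1%E.
Proof.
rewrite gmean_mean; last 2 first.
- exact: measurable_likelihood.
- exact: likelihood_ge0.
apply/eqP; rewrite eq_le; apply/andP; split.
  by apply: mean_le_e => b; rewrite gmean_likelihood.
by apply: mean_ge_e => b; rewrite gmean_likelihood.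
Qed.

Lemma gmean_mean_excess : (gmean (mean excess) <= eta%:E)%E.
Proof.
rewrite gmean_mean; last 2 first.
- exact: measurable_excess.
- exact: excess_ge0.
apply: mean_le_e; exact: gmean_excess.
Qed.

Lemma gmean_mean_truncated : ((1 - eta)%:E <= gmean (mean truncated))%E.
Proof.
rewrite gmean_mean; last 2 first.
- exact: measurable_truncated.
- exact: truncated_ge0.
apply: mean_ge_e; exact: gmean_truncated.
Qed.

Lemma mean_split w : mean likelihood w = mean truncated w + mean excess w.
Proof.
rewrite /mean -mulrDr -big_split /=; congr (_ * _).
by apply: eq_bigr => b _; exact: likelihood_split.
Qed.

(** Dominates the squared norm of the truncated-likelihood average of the tensors x_b^{(d)}: the
    inner products of these tensors are replaced by their positive parts, which keeps every
    integrand nonnegative. *)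
Definition energy w : R :=
  mean (fun b w => mean (fun b' w => overlap_pos b b' * (truncated b w * truncated b' w)) w) w.

Lemma measurable_truncated_pair b b' : measurable_fun setT (fun w => truncated b w * truncated b' w).
Proof. by apply: measurable_funM; exact: measurable_truncated. Qed.

Lemma truncated_pair_ge0 b b' w : 0 <= truncated b w * truncated b' w.
Proof. by rewrite mulr_ge0// truncated_ge0. Qed.

Lemma overlap_pos_ge0 b b' : 0 <= overlap_pos b b'.
Proof. by rewrite le_max lexx. Qed.

Lemma measurable_energy : measurable_fun setT energy.
Proof.
apply: measurable_mean => b; apply: measurable_mean => b'.
by apply: measurable_funM => //; exact: measurable_truncated_pair.
Qed.

Lemma energy_ge0 w : 0 <= energy w.
Proof.
apply: mean_ge0 => b v; apply: mean_ge0 => b' v'.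
by rewrite mulr_ge0 ?overlap_pos_ge0 ?truncated_pair_ge0.
Qed.

(** * Bounds on tests and estimators from the truncated second moment *)

Section second_moment.
Variables (a u : R).
Hypothesis aE : a = (lambda ^+ 2 + 2 * lambda * delta) / 2.
Hypothesis hu : forall b,
  2^-1 ^+ n * \sum_(b' : n.-tuple bool) second_moment_excess d a b b' <= u.

Let a0 : 0 <= a.
Proof. by rewrite aE divr_ge0// addr_ge0 ?sqr_ge0// !mulr_ge0. Qed.

Let G b b' := expR (n%:R * a * (overlap_pos b b' / (1 + overlap_pos b b'))).

Let G1 b b' : 1 <= G b b'.
Proof.
have r0 := overlap_pos_ge0 b b'.
by rewrite leNgt expR_lt1 -leNgt !mulr_ge0// invr_ge0 addr_ge0.
Qed.

Lemma gmean_sqr_mean_truncated :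
  (gmean (fun w => mean truncated w ^+ 2)%R <= (1 + u)%:E)%E.
Proof.
have -> : (fun w => mean truncated w ^+ 2) =
    mean (fun b => mean (fun b' w => truncated b w * truncated b' w)).
  apply/funext => w; rewrite /mean expr2 -!mulrA; congr (_ * _).
  rewrite mulr_suml; apply: eq_bigr => b _; rewrite mulrCA; congr (_ * _).
  by rewrite mulr_sumr.
rewrite gmean_mean; last 2 first.
- by move=> b; apply: measurable_mean => b'; exact: measurable_truncated_pair.
- by move=> b; apply: mean_ge0 => b' w; exact: truncated_pair_ge0.
apply: mean_le_e => b; rewrite gmean_mean; last 2 first.
- by move=> b'; exact: measurable_truncated_pair.
- by move=> b' w; exact: truncated_pair_ge0.
apply: (@le_trans _ _ (2^-1 ^+ n * \sum_b' (1 + second_moment_excess d a b b'))%:E).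
  rewrite EFinM -sumEFin lee_wpmul2l ?lee_fin ?exprn_ge0//; apply: lee_sum => b' _.
  rewrite (le_trans (gmean_truncated_pair _ _ aE))// lee_fin -/(G b b').
  rewrite /second_moment_excess -/(overlap_pos b b') -/(G b b').
  have := overlap_pos_ge0 b b'; have := G1 b b'; nra.
by rewrite lee_fin big_split mulrDr mean_cst lerD2l.
Qed.

(** The pair bound gives r G, and r G <= (1 + r) G - 1 because G >= 1. *)
Lemma gmean_energy : (gmean energy <= u%:E)%E.
Proof.
rewrite gmean_mean; last 2 first.
- move=> b; apply: measurable_mean => b'.
  by apply: measurable_funM => //; exact: measurable_truncated_pair.
- move=> b; apply: mean_ge0 => b' w.
  by rewrite mulr_ge0 ?overlap_pos_ge0 ?truncated_pair_ge0.
apply: mean_le_e => b; rewrite gmean_mean; last 2 first.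
- by move=> b'; apply: measurable_funM => //; exact: measurable_truncated_pair.
- by move=> b' w; rewrite mulr_ge0 ?overlap_pos_ge0 ?truncated_pair_ge0.
apply: le_trans (_ : _ <= (2^-1 ^+ n * \sum_b' second_moment_excess d a b b')%:E)%E _; last by rewrite lee_fin.
rewrite EFinM -sumEFin lee_wpmul2l ?lee_fin ?exprn_ge0//; apply: lee_sum => b' _.
rewrite gmeanZ ?overlap_pos_ge0//; last 2 first.
- exact: measurable_truncated_pair.
- by move=> w; exact: truncated_pair_ge0.
apply: (@le_trans _ _ ((overlap_pos b b')%:E * (G b b')%:E)%E).
  by rewrite lee_wpmul2l ?lee_fin ?overlap_pos_ge0// (gmean_truncated_pair _ _ aE).
rewrite -EFinM lee_fin /second_moment_excess -/(overlap_pos b b') -/(G b b').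
have := overlap_pos_ge0 b b'; have := G1 b b'; nra.
Qed.

(** The left side is at most the null mean of max(L, 1) for the averaged likelihood L. Writing L = M
    + excess with M the truncated part, (M - 1)^+ <= c/2 + (M - 1)^2/(2c), and the mean of (M - 1)^2
    is at most u + 2 eta. *)
Lemma test_bound (t : tensor R d n -> bool) (c : R) : 0 < c ->
  measurable_fun setT t ->
  ((2^-1 ^+ n)%:E * \sum_b gmean (fun w => (t w)%:R * likelihood b w)%R +
   gmean (fun w => (~~ t w)%:R)%R <=
   (1 + 2 * eta * (1 + c^-1) + c / 2 + u / (2 * c))%:E)%E.
Proof.
move=> c0 mt.
have mt' : measurable_fun setT (fun w => (t w)%:R : R).
  rewrite (_ : (fun w => _) = (fun w => if t w then 1 else 0)); last first.
    by apply/funext => w; case: (t w).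
  exact: measurable_fun_ifT.
have mnt : measurable_fun setT (fun w => (~~ t w)%:R : R).
  rewrite (_ : (fun w => _) = (fun w => if t w then 0 else 1)); last first.
    by apply/funext => w; case: (t w).
  exact: measurable_fun_ifT.
have i0 : 0 < c^-1 by rewrite invr_gt0.
set X := (X in (X <= _)%E).
have mM := measurable_mean measurable_truncated.
have M0 := mean_ge0 truncated_ge0.
have mE := measurable_mean measurable_excess.
have E0 := mean_ge0 excess_ge0.
have mL b : measurable_fun setT (fun w => (t w)%:R * likelihood b w).
  by apply: measurable_funM => //; exact: measurable_likelihood.
have XE : X = gmean (fun w => mean (fun b w => (t w)%:R * likelihood b w) w + (~~ t w)%:R).
  rewrite gmeanD//.
  - by rewrite gmean_mean// => b w; rewrite mulr_ge0// likelihood_ge0.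
  - exact: measurable_mean.
  - by apply: mean_ge0 => b w; rewrite mulr_ge0// likelihood_ge0.
have X0 : (0 <= X)%E.
  rewrite XE; apply: gmean_ge0 => w; rewrite addr_ge0//.
  by apply: mean_ge0 => b v; rewrite mulr_ge0// likelihood_ge0.
pose Y := gmean (mean truncated).
(* The cross term -M/c of (M - 1)^2/(2c) is moved to the left, so that only nonnegative functions
   are integrated. *)
have key : (X + (c^-1)%:E * Y <=
    gmean (mean excess) + ((1 + c / 2 + c^-1 / 2)%:E +
    (c^-1 / 2)%:E * gmean (fun w => mean truncated w ^+ 2)%R))%E.
  have mM2 : measurable_fun setT (fun w => mean truncated w ^+ 2).
    by apply: measurable_funX.
  rewrite XE /Y -gmeanZ ?(ltW i0)// -[X in (_ + _ <= _ + (_ + X))%E]gmeanZ//; last 2 first.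
  - by move=> w; rewrite sqr_ge0.
  - by rewrite divr_ge0// ltW.
  have q0 : 0 <= c^-1 / 2 by rewrite divr_ge0// ltW.
  have k0 : 0 <= 1 + c / 2 + c^-1 / 2 by rewrite !addr_ge0 ?divr_ge0 ?(ltW i0) ?(ltW c0).
  rewrite -(gmean_cst d n (1 + c / 2 + c^-1 / 2)) -!gmeanD//.
  - apply: le_gmean.
    + apply: measurable_funD; last exact: measurable_funM.
      by apply: measurable_funD => //; exact: measurable_mean.
    + apply: measurable_funD => //; apply: measurable_funD => //.
      exact: measurable_funM.
    + move=> w; rewrite addr_ge0//; last by rewrite mulr_ge0// ltW.
      rewrite addr_ge0//; apply: mean_ge0 => b v; rewrite mulr_ge0// likelihood_ge0//.
    + move=> w; rewrite {1}/mean.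
      have -> : \sum_b (t w)%:R * likelihood b w = (t w)%:R * \sum_b likelihood b w.
        by rewrite mulr_sumr.
      rewrite mulrCA -/(mean likelihood w) mean_split.
      have E0w := E0 w.
      set M := mean truncated w; set Ex := mean excess w in E0w *.
      have e1 : 0 <= (M - 1 - c) ^+ 2 * (c^-1 / 2).
        by rewrite mulr_ge0 ?sqr_ge0// divr_ge0// ltW.
      have e2 : 0 <= (M - 1) ^+ 2 * (c^-1 / 2).
        by rewrite mulr_ge0 ?sqr_ge0// divr_ge0// ltW.
      have e3 : (M - 1 - c) ^+ 2 * (c^-1 / 2) =
          M ^+ 2 * c^-1 / 2 - M * c^-1 - M + c^-1 / 2 + 1 + c / 2.
        by field; rewrite gt_eqF.
      case: (t w); rewrite /=; lra.
  - by apply: measurable_funD => //; apply: measurable_funM.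
  - by move=> w; apply: addr_ge0 => //; apply: mulr_ge0 => //; exact: sqr_ge0.
  - by apply: measurable_funM.
  - by move=> w; apply: mulr_ge0 => //; exact: sqr_ge0.
  - by apply: measurable_funD => //; exact: measurable_mean.
  - by apply: measurable_funM.
  - move=> w; rewrite addr_ge0//; apply: mean_ge0 => b v; rewrite mulr_ge0// likelihood_ge0//.
  - by move=> w; rewrite mulr_ge0 ?(ltW i0).
have h1 := gmean_mean_excess; have h2 := gmean_mean_truncated.
have h3 := gmean_sqr_mean_truncated.
have h4 : (0 <= gmean (mean excess))%E by exact: gmean_ge0.
have h5 : (0 <= gmean (fun w => mean truncated w ^+ 2)%R)%E.
  by apply: gmean_ge0 => w; rewrite sqr_ge0.
have [e eE e1] := bounded_ereal h4 h1.
have [q qE q1] := bounded_ereal h5 h3.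
move: key h2; rewrite eE qE -/Y; clearbody X Y.
case: Y => [y| |] //; last first.
  by case: X XE X0 => [x| |] // _ _; rewrite gt0_muley ?lte_fin.
case: X XE X0 => [x| |] // _ _.
rewrite -!EFinM -!EFinD !lee_fin => key h2.
have : c^-1 * (1 - eta) <= c^-1 * y by rewrite ler_wpM2l// ltW.
have : c^-1 / 2 * q <= c^-1 / 2 * (1 + u) by rewrite ler_wpM2l// divr_ge0// ltW.
have -> : u / (2 * c) = c^-1 / 2 * u by field; rewrite gt_eqF.
have e0 := expR_ge0 (- (n%:R * delta ^+ 2 / 4)).
have : 0 <= eta * c^-1 by rewrite mulr_ge0// ltW.
by lra.
Qed.

(** Adding 1 to the correlation makes the integrand nonnegative. On the excess part the correlation
    is bounded by 1; on the truncated part its average is a single inner product with the unit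
    tensor y^{(d)}, controlled by [energy]. *)
Lemma estimator_bound (y : tensor R d n -> vec R n) (c : R) : 0 < c ->
  measurable_fun setT y -> (forall w, inner (y w) (y w) = 1) ->
  ((2^-1 ^+ n)%:E * \sum_b gmean (fun w =>
      (1 + inner (cube R b) (y w) ^+ d) * likelihood b w)%R <=
   (1 + eta + c / 2 + u / (2 * c))%:E)%E.
Proof.
move=> c0 my y1.
have i0 : 0 < c^-1 by rewrite invr_gt0.
pose h b w := inner (cube R b) (y w) ^+ d.
have mh b : measurable_fun setT (h b).
  apply: measurable_funX; apply: measurable_sum => k; apply: measurable_funM => //.
  exact: (measurableT_comp (measurable_tnth k) my).
have hle b w : -1 <= h b w <= 1 by rewrite -ler_norml inner_cube_le1.
have mL b : measurable_fun setT (fun w => (1 + h b w) * likelihood b w).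
  apply: measurable_funM; last exact: measurable_likelihood.
  exact: measurable_funD.
have L0 b w : 0 <= (1 + h b w) * likelihood b w.
  by rewrite mulr_ge0 ?likelihood_ge0//; have /andP[] := hle b w; lra.
rewrite -gmean_mean//.
have le w : mean (fun b w => (1 + h b w) * likelihood b w) w <=
    mean likelihood w + (mean excess w + (c / 2 + c^-1 / 2 * energy w)).
  have part1 : mean (fun b w => (1 + h b w) * likelihood b w) w <=
      mean likelihood w + (mean excess w + mean (fun b w => h b w * truncated b w) w).
    rewrite /mean -!mulrDr ler_wpM2l ?exprn_ge0// -!big_split /= ler_sum// => b _.
    rewrite mulrDl mul1r lerD2l {1}likelihood_split.
    have /andP[_ h1] := hle b w.
    have : h b w * excess b w <= excess b w by rewrite ler_piMl// excess_ge0.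
    lra.
  apply: (le_trans part1); rewrite !lerD2l.
  (* The likelihood-weighted mean tensor; Young's inequality bounds its inner product with y^{(d)}
     by c/2 plus its squared norm over 2c. *)
  pose M k := 2^-1 ^+ n * \sum_b truncated b w * tnth (tpow d (cube R b)) k.
  have -> : mean (fun b w => h b w * truncated b w) w = \sum_(k < N) M k * tnth (tpow d (y w)) k.
    rewrite /mean /M.
    under [RHS]eq_bigr do rewrite -mulrA mulr_suml.
    rewrite -mulr_sumr exchange_big /=; congr (_ * _); apply: eq_bigr => b _.
    rewrite /h -inner_tpow mulr_suml; apply: eq_bigr => k _; ring.
  have part2 : \sum_(k < N) M k * tnth (tpow d (y w)) k <=
      c / 2 + c^-1 / 2 * \sum_(k < N) M k ^+ 2.
    have -> : c / 2 = c / 2 * \sum_(k < N) tnth (tpow d (y w)) k * tnth (tpow d (y w)) k.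
      by rewrite inner_tpow y1 expr1n mulr1.
    rewrite !mulr_sumr -big_split ler_sum// => k _ /=.
    set p := M k; set q := tnth _ _.
    have : 0 <= (p - c * q) ^+ 2 * (c^-1 / 2).
      by rewrite mulr_ge0 ?sqr_ge0// divr_ge0// ltW.
    have -> : (p - c * q) ^+ 2 * (c^-1 / 2) = c^-1 / 2 * p ^+ 2 - p * q + c / 2 * (q * q).
      by field; rewrite gt_eqF.
    lra.
  apply: (le_trans part2); rewrite lerD2l ler_wpM2l ?divr_ge0 ?(ltW i0)//.
  have -> : \sum_(k < N) M k ^+ 2 = mean (fun b w => mean (fun b' w =>
      overlap R b b' ^+ d * (truncated b w * truncated b' w)) w) w.
    rewrite /mean /M.
    under eq_bigr do rewrite expr2 -mulrA.
    rewrite -mulr_sumr; congr (_ * _).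
    under eq_bigr do rewrite mulr_suml.
    rewrite exchange_big /=; apply: eq_bigr => b _.
    under eq_bigr do rewrite mulrCA mulr_sumr.
    rewrite -mulr_sumr; congr (_ * _).
    rewrite exchange_big /=; apply: eq_bigr => b' _.
    rewrite /overlap -inner_tpow mulr_suml; apply: eq_bigr => k _; ring.
  rewrite /energy /mean ler_wpM2l ?exprn_ge0// ler_sum// => b _.
  rewrite ler_wpM2l ?exprn_ge0// ler_sum// => b' _.
  by rewrite ler_wpM2r ?truncated_pair_ge0// le_max lexx orbT.
have mlik := measurable_mean measurable_likelihood.
have lik0 := mean_ge0 likelihood_ge0.
have mE := measurable_mean measurable_excess.
have E0 := mean_ge0 excess_ge0.
have men := measurable_energy.
have c20 : 0 <= c / 2 by rewrite divr_ge0// ltW.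
have i20 : 0 <= c^-1 / 2 by rewrite divr_ge0// ltW.
apply: le_trans (le_gmean (measurable_mean mL) _ (mean_ge0 L0) le) _.
  apply: measurable_funD => //; apply: measurable_funD => //.
  by apply: measurable_funD => //; exact: measurable_funM.
have m3 : measurable_fun setT (fun w => c^-1 / 2 * energy w) by exact: measurable_funM.
have p3 w : 0 <= c^-1 / 2 * energy w by rewrite mulr_ge0// energy_ge0.
have m2 : measurable_fun setT (fun w => c / 2 + c^-1 / 2 * energy w) by exact: measurable_funD.
have p2 w : 0 <= c / 2 + c^-1 / 2 * energy w by rewrite addr_ge0.
have m1 : measurable_fun setT (fun w => mean excess w + (c / 2 + c^-1 / 2 * energy w)) by exact: measurable_funD.
have p1 w : 0 <= mean excess w + (c / 2 + c^-1 / 2 * energy w) by rewrite addr_ge0.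
rewrite (gmeanD mlik m1 lik0 p1) (gmeanD mE m2 E0 p2) gmeanD// gmean_cst.
rewrite (gmeanZ men energy_ge0 i20) gmean_mean_likelihood.
have -> : u / (2 * c) = c^-1 / 2 * u by field; rewrite gt_eqF.
have [e -> e1] := bounded_ereal (gmean_ge0 E0) gmean_mean_excess.
have [q -> q1] := bounded_ereal (gmean_ge0 energy_ge0) gmean_energy.
rewrite -!EFinM -!EFinD lee_fin.
have : c^-1 / 2 * q <= c^-1 / 2 * u by rewrite ler_wpM2l.
lra.
Qed.

End second_moment.

End truncated_likelihood.


(** * Impossibility *)

Section spiked_probabilities.
Variables (R : realType) (d n : nat).
Implicit Types (b : n.-tuple bool) (w : tensor R d n).

Lemma measurable_natr_bool (t : tensor R d n -> bool) :
  measurable_fun setT t -> measurable_fun setT (fun w => (t w)%:R : R).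
Proof.
move=> mt; rewrite (_ : (fun w => _) = (fun w => if t w then 1 else 0)).
  exact: measurable_fun_ifT.
by apply/funext => w; case: (t w).
Qed.

Lemma wignerE (t : tensor R d n -> bool) : measurable_fun setT t ->
  wigner R d n [set w | t w] = gmean (fun w => (t (symmetrize w))%:R).
Proof.
move=> mt; have mA : measurable [set w | t w].
  by rewrite -[X in measurable X]setTI; exact: mt.
rewrite -(setIT [set w | t w]) -integral_indic// integral_wigner; last 2 first.
- by apply/measurable_EFinP; exact: measurable_indic.
- by move=> w; rewrite lee_fin.
by apply: eq_integral => w _; rewrite indicE mem_setE.
Qed.

(** The shift is kept explicit here, as suits thresholding, where scores of the spiked tensor are
    computed directly; [spikedE] is the likelihood form used for impossibility. *)
Lemma spiked_shiftE lambda (t : tensor R d n -> bool) :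
  measurable_fun setT t ->
  spiked (rademacher R) d lambda n [set w | t w] =
  ((2^-1 ^+ n)%:E * \sum_b gmean (fun w =>
     (t (spike lambda (cube R b, symmetrize w)))%:R)%R)%E.
Proof.
move=> mt; have mA : measurable [set w | t w].
  by rewrite -[X in measurable X]setTI; exact: mt.
have mtr := measurable_natr_bool mt.
rewrite -(setIT [set w | t w]) -integral_indic// /spiked.
rewrite ge0_integral_distribution; last 2 first.
- by apply/measurable_EFinP; exact: measurable_indic.
- by move=> w; rewrite lee_fin.
rewrite (_ : _ \o _ = fun p => (((t (spike lambda p))%:R : R)%:E)); last first.
  apply/funext => p /=; rewrite indicE; congr (_%:R%:E).
  by rewrite mem_setE.
rewrite integral_spike_noise//.
by apply/measurable_EFinP; exact: (measurableT_comp mtr).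
Qed.

Lemma spikedE lambda (t : tensor R d n -> bool) : (0 < n)%N ->
  measurable_fun setT t ->
  spiked (rademacher R) d lambda n [set w | t w] =
  ((2^-1 ^+ n)%:E * \sum_b gmean (fun w =>
     (t (symmetrize w))%:R * likelihood lambda b w)%R)%E.
Proof.
move=> n0 mt; have mA : measurable [set w | t w].
  by rewrite -[X in measurable X]setTI; exact: mt.
have mtr := measurable_natr_bool mt.
rewrite -(setIT [set w | t w]) -integral_indic// /spiked.
rewrite ge0_integral_distribution; last 2 first.
- by apply/measurable_EFinP; exact: measurable_indic.
- by move=> w; rewrite lee_fin.
rewrite (_ : _ \o _ = fun p => (((t (spike lambda p))%:R : R)%:E)); last first.
  apply/funext => p /=; rewrite indicE; congr (_%:R%:E).
  by rewrite mem_setE.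
rewrite (@integral_spiked_noise R d n lambda (fun p => ((t p.2)%:R : R)%:E)) //.
- by apply/measurable_EFinP; exact: (measurableT_comp mtr).
Qed.

(* Splitting h into its positive and negative parts reduces both identities to
   integrals of nonnegative functions. *)
Lemma expectation_spike_noise (h : vec R n * tensor R d n -> R) :
  measurable_fun setT h -> (forall b w, `|h (cube R b, w)| <= 1) ->
  ('E_(spike_noise (rademacher R) d n)[h] + 1 =
    (2^-1 ^+ n)%:E * \sum_b gmean (fun w => 1 + h (cube R b, symmetrize w))%R /\
   1 - 'E_(spike_noise (rademacher R) d n)[h] =
    (2^-1 ^+ n)%:E * \sum_b gmean (fun w => 1 - h (cube R b, symmetrize w))%R)%E.
Proof.
move=> mh h1.
pose hp p := Num.max (h p) 0; pose hm p := Num.max (- h p) 0.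
have mhp : measurable_fun setT hp by exact: measurable_maxr.
have mhm : measurable_fun setT hm.
  by apply: measurable_maxr => //; exact: measurableT_comp.
have hp0 p : 0 <= hp p by rewrite le_max lexx orbT.
have hm0 p : 0 <= hm p by rewrite le_max lexx orbT.
pose at_ (f : vec R n * tensor R d n -> R) b w := f (cube R b, symmetrize w).
have mat f b : measurable_fun setT f -> measurable_fun setT (at_ f b).
  move=> mf; apply: measurableT_comp => //.
  by apply: measurable_fun_pair => //; exact: measurable_symmetrize.
pose I f := gmean (mean (at_ f)).
have spI (f : vec R n * tensor R d n -> R) : measurable_fun setT f -> (forall p, 0 <= f p) ->
    (\int[spike_noise (rademacher R) d n]_p (f p)%:E = I f)%E.
  move=> mf f0; rewrite integral_spike_noise.
  - rewrite /I gmean_mean => // [b|b w]; [exact: mat|exact: f0].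
  - exact/measurable_EFinP.
  - by move=> p; rewrite lee_fin.
have Ep : ('E_(spike_noise (rademacher R) d n)[h] = I hp - I hm)%E.
  rewrite unlock integralE; congr (_ - _)%E.
  - rewrite -spI//; apply: eq_integral => p _.
    by rewrite funeposE /hp EFin_max.
  - rewrite -spI//; apply: eq_integral => p _.
    by rewrite funenegE /hm EFin_max EFinN.
have mcst (f : n.-tuple bool -> tensor R d n -> R) (g : n.-tuple bool -> tensor R d n -> R) :
   (forall b, measurable_fun setT (f b)) -> (forall b w, 0 <= f b w) ->
   (forall b, measurable_fun setT (g b)) -> (forall b w, 0 <= g b w) ->
   gmean (mean (fun b w => f b w + g b w)) = (gmean (mean f) + gmean (mean g))%E.
  move=> mf f0 mg g0; rewrite -gmeanD.
  - apply: eq_integral => w _; congr EFin.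
    by rewrite /mean -mulrDr -big_split.
  - exact: measurable_mean.
  - exact: measurable_mean.
  - exact: mean_ge0.
  - exact: mean_ge0.
have mean1 : gmean (mean (fun (_ : n.-tuple bool) (_ : tensor R d n) => 1)) = 1%E.
  rewrite (_ : mean _ = fun=> 1); first by rewrite gmean_cst.
  by apply/funext => w; rewrite /mean mean_cst.
have fin (f : vec R n * tensor R d n -> R) : measurable_fun setT f -> (forall p, 0 <= f p) ->
    (forall b w, f (cube R b, w) <= 1) -> (0 <= I f <= 1)%E.
  move=> mf f0 f1; apply/andP; split.
    by apply: gmean_ge0 => w; apply: mean_ge0 => b v; exact: f0.
  rewrite -mean1; apply: le_gmean.
  - by apply: measurable_mean => b; exact: mat.
  - by apply: measurable_mean.
  - by apply: mean_ge0 => b v; exact: f0.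
  - move=> w; rewrite /mean ler_wpM2l ?exprn_ge0// ler_sum// => b _; exact: f1.
have hb b w : - 1 <= h (cube R b, w) <= 1 by rewrite -ler_norml.
have /andP[p0 p1] : (0 <= I hp <= 1)%E.
  by apply: fin => // b w; rewrite ge_max ler01 andbT; have /andP[] := hb b w.
have /andP[m0 m1] : (0 <= I hm <= 1)%E.
  by apply: fin => // b w; rewrite ge_max ler01 andbT; have /andP[] := hb b w; lra.
have decomp p : h p = hp p - hm p.
  by rewrite /hp /hm; case: (leP (h p) 0); case: (leP (- h p) 0); lra.
have mP : measurable_fun setT (fun p => 1 + h p) by exact: measurable_funD.
have mM : measurable_fun setT (fun p => 1 - h p) by exact: measurable_funB.
have P0 b w : 0 <= at_ (fun p => 1 + h p) b w by have /andP[] := hb b (symmetrize w); rewrite /at_; lra.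
have M0 b w : 0 <= at_ (fun p => 1 - h p) b w by have /andP[] := hb b (symmetrize w); rewrite /at_; lra.
(* Both identities are stated as sums of nonnegative integrals; finiteness of [I hp] and [I hm]
   allows the subtraction at the end. *)
have E1 : (1 + I hp = I (fun p => 1 + h p)%R + I hm)%E.
  rewrite -mean1 /I -!mcst//.
  - congr (gmean (mean _)); apply/funext => b; apply/funext => w.
    by rewrite /at_ decomp addrA subrK.
  - by move=> b; exact: mat.
  - by move=> b w; exact: hp0.
  - by move=> b; exact: mat.
  - by move=> b; exact: mat.
  - by move=> b w; exact: hm0.
have E2 : (1 + I hm = I (fun p => 1 - h p)%R + I hp)%E.
  rewrite -mean1 /I -!mcst//.
  - congr (gmean (mean _)); apply/funext => b; apply/funext => w.
    by rewrite /at_ decomp; lra.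
  - by move=> b; exact: mat.
  - by move=> b w; exact: hm0.
  - by move=> b; exact: mat.
  - by move=> b; exact: mat.
  - by move=> b w; exact: hp0.
have SP : ((2^-1 ^+ n)%:E * \sum_b gmean (fun w => 1 + h (cube R b, symmetrize w))%R
    = I (fun p => 1 + h p)%R)%E.
  by rewrite /I gmean_mean// => b; exact: mat.
have SM : ((2^-1 ^+ n)%:E * \sum_b gmean (fun w => 1 - h (cube R b, symmetrize w))%R
    = I (fun p => 1 - h p)%R)%E.
  by rewrite /I gmean_mean// => b; exact: mat.
rewrite Ep SP SM; move: p0 p1 m0 m1 E1 E2.
case: (I hp) => [x| |]//; case: (I hm) => [y| |]// _ _ _ _.
case: (I (fun p => 1 + h p)) => [z| |]//; case: (I (fun p => 1 - h p)) => [v| |]//.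
move=> [e1] [e2]; split; rewrite -?EFinB -?EFinD; congr EFin; lra.
Qed.

End spiked_probabilities.


Lemma half_sum_le (R : realType) (x y : \bar R) (r : R) :
  (0 <= x -> 0 <= y -> x + y <= r%:E ->
   (2^-1)%:E * x + (2^-1)%:E * y <= (r / 2)%:E)%E.
Proof.
case: x => [x| |]//; case: y => [y| |]// _ _.
rewrite -!EFinM -!EFinD !lee_fin; lra.
Qed.

Section impossibility.
Variables (R : realType) (d : nat) (lambda delta a : R).
Hypotheses (lambda0 : 0 <= lambda) (delta0 : 0 < delta).
Hypothesis aE : a = (lambda ^+ 2 + 2 * lambda * delta) / 2.
Hypothesis small_excess : forall e : R, 0 < e ->
  \forall n \near \oo, forall b : n.-tuple bool,
    2^-1 ^+ n * \sum_(b' : n.-tuple bool) second_moment_excess d a b b' <= e.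

Lemma gmean_spike n (b : n.-tuple bool) (F : tensor R d n -> R) : (0 < n)%N ->
  measurable_fun setT F -> (forall w, 0 <= F w) ->
  gmean (fun w => F (spike lambda (cube R b, symmetrize w))) =
  gmean (fun w => F (symmetrize w) * likelihood lambda b w).
Proof.
move=> n0 mF F0; rewrite /gmean.
under [RHS]eq_integral do rewrite EFinM.
rewrite -(@iid_normal_shift _ _ _ _ (fun w => (F (symmetrize w))%:E)).
- by apply: eq_integral => w _; rewrite symmetrize_addt.
- exact: noise_sd_neq0.
- apply/measurable_EFinP; apply: measurableT_comp => //; exact: measurable_symmetrize.
- by move=> w; rewrite lee_fin.
Qed.

Lemma cvg_eta (t : R) : 0 < t -> expR (- (n%:R * t)) @[n --> \oo] --> 0.
Proof.
move=> t0.
rewrite (_ : (fun n : nat => _) = (fun n => expR (- t) ^+ n)); last first.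
  by apply/funext => n; rewrite -mulrN expRM_natl.
by apply: cvg_expr; rewrite ger0_norm ?expR_ge0// expR_lt1 oppr_lt0.
Qed.

Let near_eta (e : R) : 0 < e ->
  \forall n \near \oo, expR (- (n%:R * delta ^+ 2 / 4)) <= e.
Proof.
move=> e0; have d4 : 0 < delta ^+ 2 / 4 by rewrite divr_gt0// exprn_gt0.
have h : \forall n \near \oo, expR (- (n%:R * (delta ^+ 2 / 4))) <= e.
  exact: (cvgr_le _ (cvg_eta d4)).
by apply: filterS h => n; rewrite mulrA.
Qed.

Lemma no_weak_detection : ~ weak_detection (rademacher R) d lambda.
Proof.
move=> [eps eps0 [f near_f]].
have i0 : 0 < eps^-1 by rewrite invr_gt0.
(* With c = eps and u = eps^2 in [test_bound], a truncation cost of at most [e1] leaves the success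
   probability at most 1/2 + 3 eps/4. *)
pose e1 := eps / (4 * (1 + eps^-1)).
have e10 : 0 < e1 by rewrite divr_gt0// mulr_gt0// addr_gt0.
have e20 : 0 < eps ^+ 2 by rewrite exprn_gt0.
have [n [n0 nf ne nu]] : exists n, [/\ (0 < n)%N,
    ((2^-1 + eps)%:E <= success (spiked (rademacher R) d lambda n) (wigner R d n) (f n))%E,
    expR (- (n%:R * delta ^+ 2 / 4)) <= e1 &
    forall b : n.-tuple bool,
    2^-1 ^+ n * \sum_(b' : n.-tuple bool) second_moment_excess d a b b' <= eps ^+ 2].
  near \oo => n; exists n; split; near: n.
  - exact: nbhs_infty_gt.
  - exact: near_f.
  - exact: near_eta.
  - exact: small_excess.
pose t := fun w : tensor R d n => f n (symmetrize w).
have mf : measurable_fun setT (f n) by [].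
have ms : measurable_fun setT (@symmetrize R d n) by exact: measurable_symmetrize.
have mt : measurable_fun setT t by exact: measurableT_comp.
have := test_bound n0 lambda0 (ltW delta0) aE nu eps0 mt.
have mnf : measurable_fun setT (fun w => ~~ f n w) by exact: measurable_neg.
have P1 := spikedE lambda n0 mf.
have Q1 := wignerE mnf.
rewrite -{}P1 -{}Q1.
move: nf; rewrite /success.
rewrite (_ : f n @^-1` [set true] = [set w | f n w])//.
rewrite (_ : f n @^-1` [set false] = [set w | ~~ f n w]); last first.
  by apply/seteqP; split => w /=; case: (f n w).
move=> h1 h2.
have := le_trans h1 (half_sum_le (measure_ge0 _ _) (measure_ge0 _ _) h2).
rewrite lee_fin {h1 h2}.
have : expR (- (n%:R * delta ^+ 2 / 4)) * (1 + eps^-1) <= eps / 4.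
  apply: (@le_trans _ _ (e1 * (1 + eps^-1))).
    by rewrite ler_wpM2r// addr_ge0// ltW.
  rewrite /e1 le_eqVlt; apply/orP; left; apply/eqP; field.
  by rewrite gt_eqF//= gt_eqF// addr_gt0.
have e2 : eps ^+ 2 / (2 * eps) = eps / 2 by field; rewrite gt_eqF.
rewrite e2; lra.
Unshelve. all: by end_near. Qed.

Lemma no_weak_recovery : ~ weak_recovery (rademacher R) d lambda.
Proof.
move=> [eps eps0 [xhat xhat1 near_x]].
(* With c = eps and u = eps^2/2, [estimator_bound] gives eps/8 + eps/2 + eps/4 = 7 eps/8 < eps. *)
have e10 : 0 < eps / 8 by rewrite divr_gt0.
have e20 : 0 < eps ^+ 2 / 2 by rewrite divr_gt0// exprn_gt0.
have [n [n0 nf ne nu]] : exists n, [/\ (0 < n)%N,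
    (eps%:E <= 'E_(spike_noise (rademacher R) d n)
        [fun p => (inner p.1 (xhat n (spike lambda p)) ^+ d)%R])%E,
    expR (- (n%:R * delta ^+ 2 / 4)) <= eps / 8 &
    forall b : n.-tuple bool,
    2^-1 ^+ n * \sum_(b' : n.-tuple bool) second_moment_excess d a b b' <= eps ^+ 2 / 2].
  near \oo => n; exists n; split; near: n.
  - exact: nbhs_infty_gt.
  - exact: near_x.
  - exact: near_eta.
  - exact: small_excess.
pose h p := inner p.1 (xhat n (spike lambda p)) ^+ d.
pose y := fun w : tensor R d n => xhat n (symmetrize w).
have mx : measurable_fun setT (xhat n) by [].
have msp : measurable_fun setT (@spike R d n lambda) by exact: measurable_spike.
have ms : measurable_fun setT (@symmetrize R d n) by exact: measurable_symmetrize.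
have my : measurable_fun setT y by exact: measurableT_comp.
have y1 w : inner (y w) (y w) = 1 by exact: xhat1.
have mh : measurable_fun setT h.
  apply: measurable_funX; apply: measurable_sum => k; apply: measurable_funM.
    by apply: (measurableT_comp (measurable_tnth k)).
  apply: (measurableT_comp (measurable_tnth k)).
  exact: measurableT_comp.
have inner1 b (z : vec R n) : inner z z = 1 -> `|inner (cube R b) z ^+ d| <= 1.
  by move=> z1; exact: inner_cube_le1.
have h1 b w : `|h (cube R b, w)| <= 1 by apply: inner1; exact: xhat1.
have [+ _] := expectation_spike_noise mh h1.
rewrite (_ : (\sum_b _)%E = (\sum_(b : n.-tuple bool) gmean (fun w =>
      (1 + inner (cube R b) (y w) ^+ d) * likelihood lambda b w)%R)%E); last first.
  apply: eq_bigr => b _.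
  rewrite -(@gmean_spike n b (fun v => 1 + inner (cube R b) (xhat n v) ^+ d))//.
    apply: measurable_funD => //; apply: measurable_funX.
    apply: measurable_sum => k; apply: measurable_funM => //.
    exact: (measurableT_comp (measurable_tnth k) mx).
  move=> v; have := inner1 b (xhat n v) (xhat1 _ _ n0).
  by rewrite ler_norml => /andP[]; lra.
have := estimator_bound n0 lambda0 (ltW delta0) aE nu eps0 my y1.
move=> h2 h3; rewrite -h3 in h2.
rewrite -leeBrDr// -EFinB in h2.
have := le_trans nf h2; rewrite lee_fin.
have e2 : eps ^+ 2 / 2 / (2 * eps) = eps / 4 by field; rewrite gt_eqF.
rewrite e2; lra.
Unshelve. all: by end_near. Qed.

End impossibility.


(** * Detection and recovery by thresholding *)

Section possibility.
Variables (R : realType) (d n : nat) (lambda tau : R).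
Implicit Types (b : n.-tuple bool) (w : tensor R d n).

Lemma score_spike b b' w :
  score b (spike lambda (cube R b', symmetrize w)) =
  lambda * overlap R b b' ^+ d + score b w.
Proof.
rewrite /score -(inner_tpow_symmetrize (cube R b) w) /overlap -inner_tpow.
rewrite mulr_sumr -big_split; apply: eq_bigr => k _.
rewrite [tnth (spike _ _) k]tnth_mktuple /entry enum_valK /= mulrDr.
by congr (_ + _); rewrite mulrCA.
Qed.

Lemma score_symmetrize b w : score b (symmetrize w) = score b w.
Proof. exact: inner_tpow_symmetrize. Qed.

(** Chernoff bound with tilt s times a sign [e], which treats both tails at once. *)
Lemma gmean_score_ge b (s : R) : (0 < n)%N -> 0 <= s ->
  (gmean (fun w => (s <= score b w)%R%:R) <= (expR (- (n%:R * (s ^+ 2 / 4))))%:E)%E /\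
  (gmean (fun w => (score b w <= - s)%R%:R) <= (expR (- (n%:R * (s ^+ 2 / 4))))%:E)%E.
Proof.
move=> n0 s0; have n1 : 0 < n%:R :> R by rewrite ltr0n.
have i0 : 0 <= (2 / n%:R : R)^-1 by rewrite invr_ge0 divr_ge0.
have bound (e : R) (p : tensor R d n -> bool) : e ^+ 2 = 1 -> measurable_fun setT p ->
    (forall w, p w -> s <= e * score b w) ->
    (gmean (fun w => (p w)%:R) <= (expR (- (n%:R * (s ^+ 2 / 4))))%:E)%E.
  move=> e2 mp ps.
  pose h k := (s * e) * tnth (tpow d (cube R b)) k.
  have sh w : \sum_k h k * tnth w k = s * e * score b w.
    by rewrite mulr_sumr; apply: eq_bigr => k _; rewrite /h mulrA.
  have h2 : \sum_k h k ^+ 2 = s ^+ 2.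
    under eq_bigr do rewrite /h exprMn [X in _ * X]expr2.
    by rewrite -mulr_sumr inner_tpow inner_cube// expr1n mulr1 exprMn e2 mulr1.
  have -> : - (n%:R * (s ^+ 2 / 4)) = ((\sum_k h k ^+ 2) / 2 - s ^+ 2) / (2 / n%:R).
    by rewrite h2; field; rewrite gt_eqF.
  rewrite -gmean_expR//; apply: le_gmean.
  - exact: measurable_natr_bool.
  - apply: measurableT_comp => //; apply: measurable_funM => //.
    apply: measurable_funD => //.
    by apply: measurable_sum => k; apply: measurable_funM => //; exact: measurable_tnth.
  - by [].
  - move=> w; case: (boolP (p w)) => [/ps sw|_]; last exact: expR_ge0.
    rewrite leNgt expR_lt1 -leNgt sh mulr_ge0//.
    have : 0 <= s * (e * score b w - s) by rewrite mulr_ge0// subr_ge0.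
    lra.
have ms := @measurable_score R d n b.
split.
- apply: (bound 1); rewrite ?expr1n//; first exact: measurable_fun_ler.
  by move=> w; rewrite mul1r.
- apply: (bound (-1)); rewrite ?sqrrN ?expr1n//; first exact: measurable_fun_ler.
  by move=> w; lra.
Qed.

Fixpoint first_above (s : seq (n.-tuple bool)) w : vec R n :=
  if s is b :: s' then if tau <= score b w then cube R b else first_above s' w
  (* An arbitrary cube vector, so that the estimate has norm 1 even when no score passes. *)
  else cube R [tuple of nseq n false].

Lemma measurable_first_above s : measurable_fun setT (first_above s).
Proof.
elim: s => [|b s IHs] /=; first exact: measurable_cst.
apply: measurable_fun_ifT => //.
by apply: measurable_fun_ler => //; exact: measurable_score.
Qed.

Lemma first_above_cube s w : exists b, first_above s w = cube R b.
Proof. by elim: s => [|b s IHs] /=; [eexists|case: ifP => // _; exists b]. Qed.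

Lemma first_aboveP s w : has (fun b => tau <= score b w) s ->
  exists2 b, first_above s w = cube R b & tau <= score b w.
Proof.
elim: s => //= b s IHs; case: (boolP (tau <= score b w)) => [tb _|_ /=].
  by exists b.
exact: IHs.
Qed.

Definition detect w : bool := has (fun b => tau <= score b w) (enum {: n.-tuple bool}).

Lemma measurable_detect : measurable_fun setT detect.
Proof.
rewrite /detect; elim: (enum _) => [|b s IHs] /=; first exact: measurable_cst.
apply: measurable_or => //.
by apply: measurable_fun_ler => //; exact: measurable_score.
Qed.

Lemma detectP b w : tau <= score b w -> detect w.
Proof. by move=> tb; apply/hasP; exists b; rewrite ?mem_enum. Qed.

Definition estimate w : vec R n := first_above (enum {: n.-tuple bool}) w.

Lemma measurable_estimate : measurable_fun setT estimate.
Proof. exact: measurable_first_above. Qed.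

Lemma measurable_has_score_ge (s : R) b :
  measurable_fun setT (fun w : tensor R d n => (s <= score b w)%R%:R : R).
Proof.
apply: measurable_natr_bool; apply: measurable_fun_ler => //.
exact: measurable_score.
Qed.

(** Union bound over the 2^n = exp(n ln 2) cube vectors: this is where the critical value arises. *)
Lemma gmean_sum_score_ge (s : R) : (0 < n)%N -> 0 <= s ->
  (gmean (fun w => \sum_b (s <= score b w)%R%:R)%R <=
   (expR (- (n%:R * (s ^+ 2 / 4 - ln 2))))%:E)%E.
Proof.
move=> n0 s0; rewrite gmean_sum//; last exact: measurable_has_score_ge.
have -> : expR (- (n%:R * (s ^+ 2 / 4 - ln 2))) = \sum_(b : n.-tuple bool) expR (- (n%:R * (s ^+ 2 / 4))).
  rewrite sumr_const card_tuple card_bool -[RHS]mulr_natr natrX.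
  rewrite mulrBr opprB addrC expRD; congr (_ * _).
  by rewrite expRM_natl lnK// posrE.
rewrite -sumEFin; apply: lee_sum => b _.
by have [] := gmean_score_ge b n0 s0.
Qed.

Let th1 := expR (- (n%:R * ((lambda - tau) ^+ 2 / 4))).

(** The planted vector has score [lambda] plus noise, so the test can miss only if that noise is at
    most -(lambda - tau). *)
Lemma spiked_detect : (0 < n)%N -> 0 <= tau -> tau <= lambda ->
  ((1 - th1)%:E <= spiked (rademacher R) d lambda n [set w | detect w])%E.
Proof.
move=> n0 tau0 tl; rewrite spiked_shiftE; last exact: measurable_detect.
apply: mean_ge_e => b.
have lt0 : 0 <= lambda - tau by lra.
have [_ h] := gmean_score_ge b n0 lt0.
have mb : measurable_fun setT (fun w : tensor R d n => (score b w <= - (lambda - tau))%R%:R : R).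
  apply: measurable_natr_bool; apply: measurable_fun_ler => //.
  exact: measurable_score.
have md : measurable_fun setT (fun w => (detect (spike lambda (cube R b, symmetrize w)))%:R : R).
  apply: measurable_natr_bool.
  apply: (measurableT_comp measurable_detect).
  apply: (measurableT_comp (@measurable_spike R d n lambda)).
  by apply: measurable_fun_pair => //; exact: measurable_symmetrize.
have : (1 <= gmean (fun w => (detect (spike lambda (cube R b, symmetrize w)))%:R) +
    gmean (fun w : tensor R d n => (score b w <= - (lambda - tau))%R%:R))%E.
  rewrite -gmeanD// -(gmean_cst d n 1); apply: le_gmean => //.
    exact: measurable_funD.
  move=> w; case: (leP (score b w)) => [_|sb]; first by rewrite lerDr.
  rewrite (@detectP b) ?lerDl//.
  by rewrite score_spike /overlap inner_cube// expr1n; lra.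
move=> h1; have := le_trans h1 (leeD2l _ h).
by rewrite EFinB leeBlDr.
Qed.

Lemma wigner_detect : (0 < n)%N -> 0 <= tau ->
  ((1 - expR (- (n%:R * (tau ^+ 2 / 4 - ln 2))))%:E <=
   wigner R d n [set w | ~~ detect w])%E.
Proof.
move=> n0 tau0.
have mnd : measurable_fun setT (fun w => ~~ detect w).
  by apply: measurable_neg; exact: measurable_detect.
rewrite wignerE//.
have h := gmean_sum_score_ge n0 tau0.
have md : measurable_fun setT (fun w : tensor R d n => (~~ detect (symmetrize w))%:R : R).
  apply: (measurable_natr_bool (t := fun w => ~~ detect (symmetrize w))).
  by apply: (measurableT_comp mnd); exact: measurable_symmetrize.
have ms : measurable_fun setT (fun w : tensor R d n => \sum_b (tau <= score b w)%R%:R : R).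
  by apply: measurable_sum => b; exact: measurable_has_score_ge.
have : (1 <= gmean (fun w : tensor R d n => (~~ detect (symmetrize w))%:R) +
    gmean (fun w : tensor R d n => \sum_b (tau <= score b w)%R%:R)%R)%E.
  rewrite -gmeanD//; last by move=> w; rewrite sumr_ge0.
  rewrite -(gmean_cst d n 1); apply: le_gmean => //.
    exact: measurable_funD.
  move=> w; case: (boolP (detect _)) => [/hasP[b _]|_] /=; last first.
    by rewrite lerDl sumr_ge0.
  rewrite score_symmetrize => tb.
  by rewrite add0r (bigD1 b)//= tb lerDl sumr_ge0.
move=> h1; have := le_trans h1 (leeD2l _ h).
by rewrite EFinB leeBlDr.
Qed.

(* If the planted vector and no other cube vector is misled by the noise, then
   every cube vector whose score reaches tau is correlated with the planted one. *)
Lemma recovery_lower_bound (tau' : R) : (0 < n)%N -> 0 <= tau' -> tau' <= tau -> tau <= lambda ->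
  0 < lambda ->
  (('E_(spike_noise (rademacher R) d n)
     [fun p => (inner p.1 (estimate (spike lambda p)) ^+ d)%R]) >=
  ((tau - tau') / lambda - 2 * (th1 + expR (- (n%:R * (tau' ^+ 2 / 4 - ln 2)))))%:E)%E.
Proof.
move=> n0 tau'0 tt tl l0.
have tau0 : 0 <= tau := le_trans tau'0 tt.
set c := (tau - tau') / lambda; set th2 := expR (- (n%:R * (_ - _))).
have c1 : c <= 1 by rewrite ler_pdivrMr// mul1r; lra.
have msp : measurable_fun setT (@spike R d n lambda) by exact: measurable_spike.
pose h p := inner p.1 (estimate (spike lambda p)) ^+ d.
have mh : measurable_fun setT h.
  apply: measurable_funX; apply: measurable_sum => k; apply: measurable_funM.
    by apply: (measurableT_comp (measurable_tnth k)).
  apply: (measurableT_comp (measurable_tnth k)).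
  exact: (measurableT_comp measurable_estimate).
have h1 b w : `|h (cube R b, w)| <= 1.
  apply: inner_cube_le1 => //=.
  rewrite /estimate; have [b' ->] := first_above_cube (enum {: n.-tuple bool}) (spike lambda (cube R b, w)).
  exact: inner_cube.
have [_ E] := expectation_spike_noise mh h1.
have : (1 - 'E_(spike_noise (rademacher R) d n)[h] <=
    (1 - c + 2 * (th1 + th2))%:E)%E.
  rewrite E; apply: mean_le_e => b.
  have lt0 : 0 <= lambda - tau by lra.
  have [_ g1] := gmean_score_ge b n0 lt0.
  have g2 := gmean_sum_score_ge n0 tau'0.
  have m1 : measurable_fun setT (fun w : tensor R d n => (score b w <= - (lambda - tau))%R%:R : R).
    apply: measurable_natr_bool; apply: measurable_fun_ler => //.
    exact: measurable_score.
  have m2 : measurable_fun setT (fun w : tensor R d n => \sum_b (tau' <= score b w)%R%:R : R).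
    by apply: measurable_sum => b'; exact: measurable_has_score_ge.
  have p2 w : 0 <= \sum_b (tau' <= score b w)%R%:R :> R by rewrite sumr_ge0.
  have mm : measurable_fun setT (fun w : tensor R d n => (score b w <= - (lambda - tau))%R%:R + \sum_b (tau' <= score b w)%R%:R : R).
    exact: measurable_funD.
  have c10 : 0 <= 1 - c by lra.
  (* Off the bad events 1 - h is at most 1 - c; on them it is at most 2, which the factor 2
     covers. *)
  apply: (@le_trans _ _ (gmean (fun w : tensor R d n => (1 - c) +
      2 * ((score b w <= - (lambda - tau))%R%:R + \sum_b (tau' <= score b w)%R%:R))%R)).
    apply: le_gmean.
    - apply: measurable_funB => //; apply: (measurableT_comp mh).
      by apply: measurable_fun_pair => //; exact: measurable_symmetrize.
    - by apply: measurable_funD => //; exact: measurable_funM.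
    - by move=> w; have := h1 b (symmetrize w); rewrite ler_norml => /andP[]; lra.
    - move=> w; have := h1 b (symmetrize w); rewrite ler_norml => /andP[hm _].
      have := p2 w; set S := \sum_b _ => S0.
      case: (leP (score b w)) => [_|sb] /=; first lra.
      have tb : tau <= score b (spike lambda (cube R b, symmetrize w)).
        by rewrite score_spike /overlap inner_cube// expr1n; lra.
      have [b' eb tb'] := first_aboveP (detectP tb).
      have [tb2|tb2] := leP tau' (score b' w).
        have : 1 <= S by rewrite /S (bigD1 b')//= tb2 lerDl sumr_ge0.
        lra.
      (* The selected vector reaches [tau] although its noise score is below [tau'], so the signal
         supplies lambda times overlap^d >= tau - tau'. *)
      suff : c <= h (cube R b, symmetrize w) by lra.
      rewrite /h /= /estimate eb -/(overlap R b b') ler_pdivrMr//.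
      rewrite (_ : overlap R b b' = overlap R b' b); last first.
        by rewrite /overlap /inner; apply: eq_bigr => k _; rewrite mulrC.
      move: tb'; rewrite score_spike; lra.
  rewrite gmeanD//; last 2 first.
  - exact: measurable_funM.
  - by move=> w; rewrite mulr_ge0// addr_ge0.
  rewrite gmean_cst gmeanZ//; last by move=> w; rewrite addr_ge0.
  rewrite gmeanD// [leRHS]EFinD leeD2l// [leRHS]EFinM lee_wpmul2l ?lee_fin// [leRHS]EFinD.
  exact: leeD.
have compl (x : \bar R) :
    (1 - x <= (1 - c + 2 * (th1 + th2))%:E -> (c - 2 * (th1 + th2))%:E <= x)%E.
  case: x => [x| |]//; last by rewrite leey.
  rewrite -EFinB !lee_fin; lra.
exact: compl.
Qed.

End possibility.

Lemma half_sum_squeeze (R : realType) (x y : \bar R) (r s : R) :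
  ((1 - r)%:E <= x -> (1 - s)%:E <= y -> x <= 1 -> y <= 1 ->
   (1 - (r + s) / 2)%:E <= (2^-1)%:E * x + (2^-1)%:E * y <= 1)%E.
Proof.
case: x => [x| |]//; case: y => [y| |]//.
rewrite -!EFinM -!EFinD !lee_fin => *; apply/andP; split; lra.
Qed.

HB.instance Definition _ (R : realType) d n tau :=
  isMeasurableFun.Build _ _ _ _ (@detect R d n tau) (@measurable_detect R d n tau).

HB.instance Definition _ (R : realType) d n tau :=
  isMeasurableFun.Build _ _ _ _ (@estimate R d n tau) (@measurable_estimate R d n tau).

(** * The threshold *)

Definition critical (R : realType) : R := 2 * Num.sqrt (ln 2).

Section phase_transition.
Variable R : realType.
Local Notation critical := (critical R).

Lemma ln2_gt0 : 0 < ln 2 :> R.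
Proof. by rewrite ln_gt0// ltr1n. Qed.

Lemma critical_sqr : critical ^+ 2 = 4 * ln 2.
Proof. by rewrite /critical exprMn sqr_sqrtr ?(ltW ln2_gt0)//; congr (_ * _); ring. Qed.

Lemma critical_gt0 : 0 < critical.
Proof. by rewrite /critical mulr_gt0// sqrtr_gt0 ln2_gt0. Qed.

Section above.
Variables (d : nat) (lambda : R).
Hypothesis hl : critical < lambda.

(** The thresholds cut the interval from [critical] to [lambda] in thirds: [tau'] exceeds all
    pure-noise scores, tau - tau' becomes correlation, and lambda - tau is the margin of the planted
    vector. *)
Let tau' := critical + (lambda - critical) / 3.
Let tau := critical + (lambda - critical) / 3 * 2.

Let order : [/\ 0 < critical, critical < tau', tau' < tau & tau < lambda].
Proof.
move: hl critical_gt0; rewrite /tau /tau'; move: (critical) => c h1 h2.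
by split; lra.
Qed.

Let rate (s : R) : critical < s -> 0 < s ^+ 2 / 4 - ln 2.
Proof.
move=> cs; have c0 := critical_gt0.
have : 0 < (s - critical) * (s + critical) by rewrite mulr_gt0//; lra.
have := critical_sqr; lra.
Qed.

Let rate_signal : 0 < (lambda - tau) ^+ 2 / 4.
Proof. by have [_ _ _ tl] := order; rewrite divr_gt0// exprn_gt0// subr_gt0. Qed.

Lemma strong_detection_above : strong_detection (rademacher R) d lambda.
Proof.
have [c0 ct tt tl] := order.
have t0 : 0 <= tau by lra.
exists (fun n => @detect R d n tau : {mfun _ >-> _}).
pose u (n : nat) : R := 1 - (expR (- (n%:R * ((lambda - tau) ^+ 2 / 4))) +
   expR (- (n%:R * (tau ^+ 2 / 4 - ln 2)))) / 2.
have cu : u n @[n --> \oo] --> (1 - (0 + 0) / 2 : R).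
  apply: cvgB; first exact: cvg_cst.
  apply: cvgM; last exact: cvg_cst.
  by apply: cvgD; apply: cvg_eta => //; apply: rate; exact: lt_trans tt.
have cuE : (u n)%:E @[n --> \oo] --> 1%E.
  apply: cvg_EFin; first exact: nearW.
  by move: cu; rewrite addr0 mul0r subr0.
apply: (squeeze_cvge _ cuE (cvg_cst 1%E)).
near=> n.
have n0 : (0 < n)%N by near: n; exact: nbhs_infty_gt.
have h1 := @spiked_detect R d n lambda tau n0 t0 (ltW tl).
have h2 := @wigner_detect R d n tau n0 t0.
rewrite /success.
rewrite (_ : _ @^-1` [set true] = [set w | detect tau w])//.
rewrite (_ : _ @^-1` [set false] = [set w | ~~ detect tau w]); last first.
  by apply/seteqP; split => w /=; case: (detect tau w).
have md : measurable [set w | @detect R d n tau w].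
  by rewrite -[X in measurable X]setTI; exact: measurable_detect.
have mnd : measurable [set w | ~~ @detect R d n tau w].
  rewrite -[X in measurable X]setTI.
  by apply: (measurable_neg (@measurable_detect R d n tau)).
have h3 := probability_le1 (spiked (rademacher R) d lambda n) md.
have h4 := probability_le1 (wigner R d n) mnd.
exact: half_sum_squeeze h1 h2 h3 h4.
Unshelve. all: by end_near. Qed.

Lemma weak_recovery_above : weak_recovery (rademacher R) d lambda.
Proof.
have [c0 ct tt tl] := order.
have t0 : 0 <= tau' by lra.
have l0 : 0 < lambda by lra.
pose c := (tau - tau') / lambda.
have c1 : 0 < c by rewrite divr_gt0// subr_gt0.
exists (c / 2); first by rewrite divr_gt0.
exists (fun n => @estimate R d n tau : {mfun _ >-> _}).
  move=> n T n0.
  have [b e] := first_above_cube tau (enum {: n.-tuple bool}) T.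
  by rewrite /= /estimate e; exact: inner_cube.
pose u (n : nat) : R := c - 2 * (expR (- (n%:R * ((lambda - tau) ^+ 2 / 4))) +
   expR (- (n%:R * (tau' ^+ 2 / 4 - ln 2)))).
have cu : u n @[n --> \oo] --> (c - 2 * (0 + 0) : R).
  apply: cvgB; first exact: cvg_cst.
  apply: cvgM; first exact: cvg_cst.
  by apply: cvgD; apply: cvg_eta => //; exact: rate.
have nu : \forall n \near \oo, c / 2 <= u n.
  by apply: (cvgr_ge _ cu); rewrite addr0 mulr0 subr0; lra.
near=> n.
have n0 : (0 < n)%N by near: n; exact: nbhs_infty_gt.
apply: le_trans (recovery_lower_bound d n0 t0 (ltW tt) (ltW tl) l0).
by rewrite lee_fin; near: n.
Unshelve. all: by end_near. Qed.

End above.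

Definition impossible d (lambda : R) :=
  ~ weak_detection (rademacher R) d lambda /\
  ~ weak_recovery (rademacher R) d lambda.

(** A single [a], the midpoint of l^2/2 and 2 ln 2, serves every positive lambda < l, by solving
    (lambda^2 + 2 lambda delta)/2 = a for a positive [delta]. Hence how large [d] must be does not
    depend on [lambda]. *)
Lemma impossible_below (l : R) : 0 <= l -> l < critical ->
  \forall d \near \oo, forall lambda, 0 <= lambda -> lambda < l -> impossible d lambda.
Proof.
move=> l0 lc; pose a := (l ^+ 2 / 2 + 2 * ln 2) / 2.
have l2 : l ^+ 2 < 4 * ln 2.
  have : 0 < (critical - l) * (critical + l) by have := critical_gt0 => c0; rewrite mulr_gt0//; lra.
  have := critical_sqr; lra.
have a0 : 0 <= a.
  by rewrite divr_ge0// addr_ge0 ?divr_ge0 ?sqr_ge0// mulr_ge0// ltW// ln2_gt0.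
have a1 : a < 2 * ln 2 by rewrite /a; lra.
have z1 : 0 < 2 * ln 2 :> R by rewrite mulr_gt0// ln2_gt0.
have near_a := mean_second_moment_excess a0 a1.
have near_0 := mean_second_moment_excess (lexx 0) z1.
apply: filterS2 near_a near_0 => d ha h0 lambda lam0 laml.
(* At lambda = 0 the equation for [delta] degenerates; there a = 0 and delta = 1 are used. *)
have [lam00|lampos] := leP lambda 0.
  have lamE : lambda = 0 by lra.
  have aE : 0 = (lambda ^+ 2 + 2 * lambda * 1) / 2 by rewrite lamE; ring.
  by split; [exact: (no_weak_detection lam0 ltr01 aE h0)|exact: (no_weak_recovery lam0 ltr01 aE h0)].
pose delta := (2 * a - lambda ^+ 2) / (2 * lambda).
have lam2 : lambda ^+ 2 < l ^+ 2.
  have : 0 < (l - lambda) * (l + lambda) by rewrite mulr_gt0//; lra.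
  lra.
have delta0 : 0 < delta.
  by rewrite divr_gt0 ?mulr_gt0// /a; lra.
have aE : a = (lambda ^+ 2 + 2 * lambda * delta) / 2.
  by rewrite /delta; field; rewrite gt_eqF.
by split; [exact: (no_weak_detection lam0 delta0 aE ha)|exact: (no_weak_recovery lam0 delta0 aE ha)].
Qed.

(** The cap at [critical] bounds the set, so [sup] is a true supremum and the upper half of the
    limit is immediate. *)
Definition threshold_set d : set R :=
  [set l | 0 <= l <= critical /\
    forall lambda, 0 <= lambda -> lambda < l -> impossible d lambda].

Lemma threshold_set0 d : threshold_set d 0.
Proof.
split; first by rewrite lexx ltW// critical_gt0.
by move=> lambda l0 /(le_lt_trans l0); rewrite ltxx.
Qed.

Lemma threshold_set_ub d : ubound (threshold_set d) critical.
Proof. by move=> l [/andP[]]. Qed.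

Lemma cvg_threshold : sup (threshold_set d) @[d --> \oo] --> critical.
Proof.
apply/cvgrPdist_le => e e0.
have supc d : sup (threshold_set d) <= critical.
  by apply: ge_sup; [exists 0; exact: threshold_set0|exact: threshold_set_ub].
(* For large [d] this [l] belongs to the set, which places the supremum within [e] of [critical];
   the maximum with 0 covers large [e]. *)
pose l := Num.max 0 (critical - e).
have l0 : 0 <= l by rewrite le_max lexx.
have lc : l < critical by rewrite gt_max critical_gt0/= ltrBlDr ltrDl.
apply: filterS (impossible_below l0 lc) => d hd.
have hl : threshold_set d l by split => //; rewrite l0 ltW.
have : l <= sup (threshold_set d).
  by apply: ub_le_sup => //; exists critical; exact: threshold_set_ub.
have : critical - e <= l by rewrite le_max lexx orbT.
have := supc d => h1 h2 h3.
by rewrite ger0_norm ?subr_ge0// lerBlDr -lerBlDl; exact: le_trans h3.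
Qed.

End phase_transition.

Unset Implicit Arguments.

Theorem theorem1p4 (R : realType) :
  exists lambda_star : nat -> R,
    lambda_star d @[d --> \oo] --> 2 * Num.sqrt (ln 2) /\
    forall (d : nat) (lambda : R), (3 <= d)%N -> 0 <= lambda ->
      (lambda < lambda_star d ->
        ~ weak_detection (rademacher R) d lambda /\
        ~ weak_recovery (rademacher R) d lambda) /\
      (2 * Num.sqrt (ln 2) < lambda ->
        strong_detection (rademacher R) d lambda /\
        weak_recovery (rademacher R) d lambda).
Proof.
exists (fun d => sup (@threshold_set R d)); split; first exact: cvg_threshold.
move=> d lambda _ lambda0; split => [ltsup|above].
  have ne : @threshold_set R d !=set0 by exists 0; exact: threshold_set0.
  (* Below the supremum some member [l] of the set exceeds [lambda], and membership of [l] rules out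
     both tasks at [lambda]. *)
  by have [l [_ hl] lambdal] := sup_gt ne ltsup; exact: hl.
by split; [exact: strong_detection_above|exact: weak_recovery_above].
Qed.
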